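(* Let $D\subset\mathbb{R}^n$ be a domain, $E=D\times\mathbb{R}^r$ the trivial vector bundle over $D$, and $1\le q\le n$. Let $\{g_j\}$ be a sequence of $C^2$ Riemannian metrics on $E$, each of which makes $(E,g_j)$ Nakano $q$-semipositive, and suppose $\{g_j\}$ increasingly converges to a $C^2$ Riemannian metric $g$ on $E$, i.e. $g_i\le g_j\le g$ for all $i\le j$. Then $(E,g)$ is Nakano $q$-semipositive.
   Context: A Riemannian metric on $E$ is a map $g:D\to\mathrm{Sym}^+_r(\mathbb{R})$; $g_i\le g_j$ means $g_j-g_i$ is positive semidefinite pointwise. For $E$-valued $q$-forms $\alpha=\sum_\tau(\sum_{|I|=q}\alpha_{I,\tau}dx_I)\otimes e_\tau$, $\langle\alpha,\beta\rangle_g=\sum_{\tau,\xi}\sum_I\alpha_{I,\tau}\beta_{I,\xi}g_{\tau\xi}$. The curvature operator of $g$ is $\Theta_E=-\sum_{i,j=1}^n\frac{\partial}{\partial x_i}\big(g^{-1}\frac{\partial g}{\partial x_j}\big)\,dx_i\wedge\big(\frac{\partial}{\partial x_j}\lrcorner\,\cdot\big)$ (matrix acting on fiber coefficients). $(E,g)$ is Nakano $q$-semipositive if $\langle\Theta_E\alpha,\alpha\rangle_g\ge0$ at every point of $D$ for every $E$-valued $q$-form $\alpha$. *)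

(* Defs.v *)
From HB Require Import structures.
From mathcomp Require Import all_boot all_order all_algebra.
From mathcomp Require Import all_classical all_reals all_analysis.
Set Implicit Arguments. Unset Strict Implicit. Unset Printing Implicit Defensive.
Import Order.TTheory GRing.Theory Num.Theory.
Import numFieldNormedType.Exports.
Local Open Scope classical_set_scope.
Local Open Scope ring_scope.

Section Nakano.
Variables (R : realType) (n r : nat).

Definition coord_vec (i : 'I_n) : 'rV[R]_n := delta_mx 0 i.

Definition pd (i : 'I_n) (f : 'rV[R]_n -> R) : 'rV[R]_n -> R :=
  fun x => 'D_(coord_vec i) f x.

Definition C2_on (D : set 'rV[R]_n) (f : 'rV[R]_n -> R) : Prop :=
  (forall x, D x -> {for x, continuous f}) /\
  forall i : 'I_n,
    (forall x, D x -> derivable f x (coord_vec i)) /\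
    (forall x, D x -> {for x, continuous (pd i f)}) /\
    forall j : 'I_n,
      (forall x, D x -> derivable (pd i f) x (coord_vec j)) /\
      (forall x, D x -> {for x, continuous (pd j (pd i f))}).

Definition domain (D : set 'rV[R]_n) : Prop := open D /\ connected D.

Definition riemannian_metric (D : set 'rV[R]_n) (g : 'rV[R]_n -> 'M[R]_r) :=
  forall x, D x -> (g x)^T = g x /\
    forall v : 'rV[R]_r, v != 0 -> 0 < (v *m g x *m v^T) 0 0.

Definition C2_metric (D : set 'rV[R]_n) (g : 'rV[R]_n -> 'M[R]_r) :=
  riemannian_metric D g /\ forall a b : 'I_r, C2_on D (fun y => g y a b).

Definition mx_le (A B : 'M[R]_r) : Prop :=
  forall v : 'rV[R]_r, 0 <= (v *m (B - A) *m v^T) 0 0.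

Definition dmx (j : 'I_n) (g : 'rV[R]_n -> 'M[R]_r) (y : 'rV[R]_n) : 'M[R]_r :=
  \matrix_(a, b) pd j (fun z => g z a b) y.

Definition curv_coef (g : 'rV[R]_n -> 'M[R]_r) (i j : 'I_n) (x : 'rV[R]_n)
  : 'M[R]_r :=
  \matrix_(a, b) pd i (fun y => (invmx (g y) *m dmx j g y) a b) x.

(* E-valued q-forms at a point: coefficients alpha I tau, I ranging over
   the subsets of {1..n} of size q (dx_I = dx_{i1} /\ ... /\ dx_{iq},
   i1 < ... < iq); the values of alpha at sets of other sizes are ignored. *)
Definition form := {set 'I_n} -> 'I_r -> R.

(* coefficient of dx_K in dx_i /\ (d/dx_j _| dx_I) *)
Definition wedge_contr (I : {set 'I_n}) (i j : 'I_n) (K : {set 'I_n}) : R :=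
  if [&& j \in I, i \notin I :\ j & K == (I :\ j) :|: [set i]]
  then (-1) ^+ (#|[set k in I | (k < j)%N]| + #|[set k in I :\ j | (k < i)%N]|)
  else 0.

Definition Theta (g : 'rV[R]_n -> 'M[R]_r) (q : nat) (x : 'rV[R]_n)
  (alpha : form) : form :=
  fun K tau =>
    - \sum_(i < n) \sum_(j < n) \sum_(I : {set 'I_n} | #|I| == q)
        wedge_contr I i j K *
        \sum_(s < r) curv_coef g i j x tau s * alpha I s.

Definition form_inner (q : nat) (G : 'M[R]_r) (alpha beta : form) : R :=
  \sum_(K : {set 'I_n} | #|K| == q) \sum_(tau < r) \sum_(xi < r)
    alpha K tau * beta K xi * G tau xi.

Definition nakano_q_semipositive (D : set 'rV[R]_n) (q : nat)
  (g : 'rV[R]_n -> 'M[R]_r) : Prop :=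
  forall x, D x -> forall alpha : form,
    0 <= form_inner q (g x) (Theta g q x alpha) alpha.

End Nakano.

(* Main.v *)
(** Write [W = g_m - g], [E_i = d_i W] and
    [L_ij(g) = d_i d_j g - d_i g g^-1 d_j g], so that [g Theta_ij = - L_ij(g)] and
    the curvature form of [alpha] is [- sum_ij tr (L_ij(g) C_ij)] with constant
    matrices [C_ij]. Its second order part is linear in [g], hence stable under
    weak limits; what has to be controlled is the quadratic part, that is, strong
    [L^2] convergence of the first derivatives. Summing the hypothesis over the
    forms [dx_I (x) v] gives [sum_i L_ii(g_m) <= 0], and since [W] tends to [0]
    uniformly (Dini), integrating [|E_i|^2] by parts against a cut-off bounds it by
    [sup |W|].

    Integration is avoided: the estimates are kept pointwise, as
    [delta chi^2 <= div F + tau] on a cube with [F = 0] on the faces, and this is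
    averaged over finer and finer grids, where the averages of [div F] tend to [0]
    by telescoping. *)
Require Import Defs.
From HB Require Import structures.
From mathcomp Require Import all_boot all_order all_algebra.
From mathcomp Require Import all_classical all_reals all_analysis.
From mathcomp Require Import perm ring lra.
Set Implicit Arguments. Unset Strict Implicit. Unset Printing Implicit Defensive.
Import Order.TTheory GRing.Theory Num.Theory.
Import numFieldNormedType.Exports.
Local Open Scope classical_set_scope.
Local Open Scope ring_scope.

(** * Functions of class C1 *)

Section C1_functions.
Variables (R : realType) (n : nat) (D : set 'rV[R]_n).
Hypothesis D_open : open D.
Implicit Types (f h : 'rV[R]_n -> R) (x : 'rV[R]_n) (i : 'I_n).

Definition C1_on f : Prop := forall x, D x -> {for x, continuous f} /\
  forall i, derivable f x (coord_vec R i) /\ {for x, continuous (pd i f)}.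

Lemma near_domain x : D x -> \forall y \near x, D y.
Proof. by move=> Dx; apply: open_nbhs_nbhs; split. Qed.

Lemma C1_continuous f x : C1_on f -> D x -> {for x, continuous f}.
Proof. by move=> Cf /Cf[]. Qed.

Lemma C1_derivable f x : C1_on f -> D x -> forall i, derivable f x (coord_vec R i).
Proof. by move=> Cf /Cf[_ H] i; have [] := H i. Qed.

Lemma C1_pd_continuous f x : C1_on f -> D x ->
  forall i, {for x, continuous (pd i f)}.
Proof. by move=> Cf /Cf[_ H] i; have [] := H i. Qed.

Lemma near_continuous f h x :
  (\forall y \near x, f y = h y) -> {for x, continuous f} -> {for x, continuous h}.
Proof.
move=> fh cf; have fhx := nbhs_singleton fh.
rewrite /prop_for /continuous_at -fhx.
by apply: cvg_trans cf; exact: (near_eq_cvg fh).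
Qed.

Lemma on_eq_continuous f h x : (forall y, D y -> f y = h y) -> D x ->
  {for x, continuous f} -> {for x, continuous h}.
Proof.
move=> fh Dx cf; apply: near_continuous cf.
by apply: filterS (near_domain Dx) => y; exact: fh.
Qed.

Lemma on_eq_pd f h x i : (forall y, D y -> f y = h y) -> D x ->
  pd i f x = pd i h x.
Proof.
by move=> fh Dx; apply: near_eq_derive; apply: filterS (near_domain Dx) => y; exact: fh.
Qed.

Lemma on_eq_C1 f h : (forall y, D y -> f y = h y) -> C1_on f -> C1_on h.
Proof.
move=> fh Cf x Dx; split; first exact: on_eq_continuous (C1_continuous Cf Dx).
move=> i; split.
  have := @C1_derivable f x Cf Dx i; apply: near_eq_derivable.
  by apply: filterS (near_domain Dx) => y; exact: fh.
apply: (@on_eq_continuous (pd i f)) (@C1_pd_continuous f x Cf Dx i) => // y Dy.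
exact: on_eq_pd.
Qed.

(** [pd i f] and [df i] coincide only on [D]; since [D] is open they agree near each of its points,
    so continuity passes from one to the other. *)
Lemma C1_intro f (df : 'I_n -> 'rV[R]_n -> R) :
  (forall x, D x -> {for x, continuous f}) ->
  (forall x, D x -> forall i, is_derive x (coord_vec R i) f (df i x)) ->
  (forall x, D x -> forall i, {for x, continuous (df i)}) -> C1_on f.
Proof.
move=> cf der cdf x Dx; split; first exact: cf.
move=> i; have dx := der x Dx i; split; first by [].
apply: (on_eq_continuous _ Dx (cdf x Dx i)) => y Dy.
by have dy := der y Dy i; rewrite /pd derive_val.
Qed.

Lemma C1_cst c : C1_on (fun=> c).
Proof.
by apply: (@C1_intro _ (fun _ _ => 0)) => x Dx *; exact: cst_continuous.
Qed.

Lemma pd_cst c i x : pd i (fun=> c) x = 0 :> R.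
Proof. exact: derive_cst. Qed.

Lemma C1_is_derive f x : C1_on f -> D x -> forall i,
  is_derive x (coord_vec R i) f (pd i f x).
Proof. by move=> Cf Dx i; apply: derivableP; exact: C1_derivable. Qed.

Lemma C1D f h : C1_on f -> C1_on h -> C1_on (fun x => f x + h x).
Proof.
move=> Cf Ch; apply: (@C1_intro _ (fun i x => pd i f x + pd i h x)) => x Dx.
- by apply: (@continuousD _ _ _ f h); exact: C1_continuous.
- move=> i; have := C1_is_derive Cf Dx i; have := C1_is_derive Ch Dx i.
  by move=> *; exact: (@is_deriveD _ _ _ f h).
- by move=> i; apply: (@continuousD _ _ _ (pd i f)); exact: C1_pd_continuous.
Qed.

Lemma pdD f h x i : C1_on f -> C1_on h -> D x ->
  pd i (fun x => f x + h x) x = pd i f x + pd i h x.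
Proof.
move=> Cf Ch Dx.
by apply: (@deriveD _ _ _ f h); exact: C1_derivable.
Qed.

Lemma C1M f h : C1_on f -> C1_on h -> C1_on (fun x => f x * h x).
Proof.
move=> Cf Ch; apply: (@C1_intro _ (fun i x => f x * pd i h x + h x * pd i f x)) => x Dx.
- by apply: (@continuousM _ _ f h); exact: C1_continuous.
- move=> i; have := C1_is_derive Cf Dx i; have := C1_is_derive Ch Dx i.
  by move=> *; exact: (@is_deriveM _ _ f h).
- move=> i; apply: (@continuousD _ _ _ (fun x => f x * pd i h x)).
  + by apply: (@continuousM _ _ f); [exact: C1_continuous|exact: C1_pd_continuous].
  + by apply: (@continuousM _ _ h); [exact: C1_continuous|exact: C1_pd_continuous].
Qed.

Lemma pdM f h x i : C1_on f -> C1_on h -> D x ->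
  pd i (fun x => f x * h x) x = pd i f x * h x + f x * pd i h x.
Proof.
move=> Cf Ch Dx; rewrite addrC (mulrC _ (h x)).
by apply: (@deriveM _ _ f h); exact: C1_derivable.
Qed.

Lemma C1N f : C1_on f -> C1_on (fun x => - f x).
Proof.
move=> Cf; apply: (on_eq_C1 _ (C1M (C1_cst (-1)) Cf)) => y _.
by rewrite mulN1r.
Qed.

Lemma pdN f x i : C1_on f -> D x -> pd i (fun x => - f x) x = - pd i f x.
Proof.
by move=> Cf Dx; apply: (@deriveN _ _ _ f); exact: C1_derivable.
Qed.

Lemma C1V f : (forall x, D x -> f x != 0) -> C1_on f -> C1_on (fun x => (f x)^-1).
Proof.
move=> f0 Cf; apply: (@C1_intro _ (fun i x => - (f x) ^- 2 * pd i f x)) => x Dx.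
- by apply: (@continuousV _ _ f); [exact: f0|exact: C1_continuous].
- move=> i; apply: DeriveDef.
    by apply: derivableV; [exact: f0|exact: C1_derivable].
  by rewrite deriveV //; [exact: f0|exact: C1_derivable].
- move=> i; apply: (@continuousM _ _ (fun x => - (f x) ^- 2)); last exact: C1_pd_continuous.
  apply: (@continuousN _ _ _ (fun x => (f x) ^- 2)).
  apply: (@continuousV _ _ (fun x => f x ^+ 2)); first by rewrite sqrf_eq0 f0.
  by apply: (@continuousM _ _ f f); exact: C1_continuous.
Qed.

Lemma C1_sum I (s : seq I) (P : pred I) (F : I -> 'rV[R]_n -> R) :
  (forall k, C1_on (F k)) -> C1_on (fun x => \sum_(k <- s | P k) F k x).
Proof.
move=> CF; elim: s => [|k s IH].
  by apply: on_eq_C1 (C1_cst 0) => y _; rewrite big_nil.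
have [Pk|Pk] := boolP (P k).
  by apply: on_eq_C1 (C1D (CF k) IH) => y _; rewrite big_cons Pk.
by apply: on_eq_C1 IH => y _; rewrite big_cons (negbTE Pk).
Qed.

Lemma pd_sum I (s : seq I) (P : pred I) (F : I -> 'rV[R]_n -> R) x i :
  (forall k, C1_on (F k)) -> D x ->
  pd i (fun x => \sum_(k <- s | P k) F k x) x = \sum_(k <- s | P k) pd i (F k) x.
Proof.
move=> CF Dx; elim: s => [|k s IH].
  by rewrite big_nil -[RHS](pd_cst 0 i x); apply: on_eq_pd => // y _; rewrite big_nil.
rewrite big_cons; have [Pk|Pk] := boolP (P k).
  rewrite -IH -(pdD i (CF k) (C1_sum s P CF)) //.
  by apply: on_eq_pd => // y _; rewrite big_cons Pk.
by rewrite -IH; apply: on_eq_pd => // y _; rewrite big_cons (negbTE Pk).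
Qed.

Lemma C1_prod I (s : seq I) (F : I -> 'rV[R]_n -> R) :
  (forall k, C1_on (F k)) -> C1_on (fun x => \prod_(k <- s) F k x).
Proof.
move=> CF; elim: s => [|k s IH].
  by apply: on_eq_C1 (C1_cst 1) => y _; rewrite big_nil.
by apply: on_eq_C1 (C1M (CF k) IH) => y _; rewrite big_cons.
Qed.

Lemma C1_coord (k : 'I_n) : C1_on (fun x => x 0 k).
Proof.
apply: (@C1_intro _ (fun i x => (i == k)%:R)) => x Dx; [exact: coord_continuous| |].
- move=> i.
  (* For nonzero h the difference quotient is constant, equal to the Kronecker delta of i and k. *)
  have H : (fun h : R => h^-1 *: ((((fun x : 'rV[R]_n => x 0 k) \o shift x)
     (h *: coord_vec R i)) - x 0 k)) @ 0^' --> ((i == k)%:R : R).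
    apply: cvg_near_cst; near=> h; rewrite /= !mxE /= addrK eq_sym.
    have h0 : h != 0 by near: h; exists 1 => //=.
    by rewrite -[_ *: _]/(_ * _) mulKf.
  apply: DeriveDef; first by apply/cvg_ex; eexists; exact: H.
  exact: cvg_lim H.
- by move=> i; exact: cst_continuous.
Unshelve. all: by end_near. Qed.

End C1_functions.

(** * Matrix-valued functions and metrics *)

Section C1_matrices.
Variables (R : realType) (n : nat) (D : set 'rV[R]_n).
Hypothesis D_open : open D.

Definition C1_mx p q (A : 'rV[R]_n -> 'M[R]_(p, q)) : Prop :=
  forall a b, C1_on D (fun x => A x a b).

Section Square.
Variable r : nat.
Implicit Types (A B : 'rV[R]_n -> 'M[R]_r) (x : 'rV[R]_n) (i j : 'I_n).

Lemma on_eq_dmx A B i x : (forall y, D y -> A y = B y) -> D x ->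
  dmx i A x = dmx i B x.
Proof.
move=> AB Dx; apply/matrixP => a b; rewrite !mxE.
by apply: (on_eq_pd D_open i _ Dx) => y Dy; rewrite AB.
Qed.

Lemma C1_mx_cst (c : 'M[R]_r) : C1_mx (fun=> c).
Proof. by move=> a b; exact: C1_cst. Qed.

Lemma dmx_cst (c : 'M[R]_r) i x : dmx i (fun=> c) x = 0.
Proof. by apply/matrixP => a b; rewrite !mxE pd_cst. Qed.

Lemma C1_mxB A B : C1_mx A -> C1_mx B -> C1_mx (fun x => A x - B x).
Proof.
move=> CA CB a b; apply: (on_eq_C1 D_open _ (C1D D_open (CA a b) (C1N D_open (CB a b)))).
by move=> y _; rewrite !mxE.
Qed.

Lemma dmxB A B i x : C1_mx A -> C1_mx B -> D x ->
  dmx i (fun y => A y - B y) x = dmx i A x - dmx i B x.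
Proof.
move=> CA CB Dx; apply/matrixP => a b; rewrite !mxE -(pdN i (CB a b) Dx).
rewrite -(pdD i (CA a b) (C1N D_open (CB a b)) Dx).
by apply: (on_eq_pd D_open i _ Dx) => y _; rewrite !mxE.
Qed.

Lemma C1_mxM A B : C1_mx A -> C1_mx B -> C1_mx (fun x => A x *m B x).
Proof.
move=> CA CB a b.
apply: (on_eq_C1 D_open _ (C1_sum D_open (index_enum _) xpredT
  (fun k => C1M D_open (CA a k) (CB k b)))).
by move=> y _; rewrite !mxE.
Qed.

Lemma dmxM A B i x : C1_mx A -> C1_mx B -> D x ->
  dmx i (fun y => A y *m B y) x = dmx i A x *m B x + A x *m dmx i B x.
Proof.
move=> CA CB Dx; apply/matrixP => a b; rewrite !mxE.
rewrite (on_eq_pd D_open (h := fun y => \sum_k A y a k * B y k b) i _ Dx); last first.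
  by move=> y _; rewrite mxE.
rewrite (pd_sum D_open (index_enum _) xpredT i
  (fun k => C1M D_open (CA a k) (CB k b)) Dx) -big_split.
by apply: eq_bigr => k _; rewrite !mxE (pdM i (CA a k) (CB k b) Dx).
Qed.

Lemma C1_trace A : C1_mx A -> C1_on D (fun x => \tr (A x)).
Proof. by move=> CA; apply: C1_sum => // k; exact: CA. Qed.

Lemma pd_trace A i x : C1_mx A -> D x ->
  pd i (fun y => \tr (A y)) x = \tr (dmx i A x).
Proof.
move=> CA Dx; rewrite /mxtrace (pd_sum D_open (index_enum _) xpredT i
  (fun k => CA k k) Dx).
by apply: eq_bigr => k _; rewrite mxE.
Qed.

End Square.

Lemma C1_det p (A : 'rV[R]_n -> 'M[R]_p) : C1_mx A -> C1_on D (fun x => \det (A x)).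
Proof.
move=> CA; apply: C1_sum => // s; apply: (C1M D_open (C1_cst D_open _)).
by apply: C1_prod => // k; exact: CA.
Qed.

Lemma C1_invmx r (A : 'rV[R]_n -> 'M[R]_r) :
  (forall x, D x -> A x \in unitmx) -> C1_mx A -> C1_mx (fun x => invmx (A x)).
Proof.
move=> UA CA a b.
(* Cramer's rule writes the entries of the inverse as rational functions of those of [A], with a
   denominator that does not vanish on [D]. *)
pose h (x : 'rV[R]_n) := (\det (A x))^-1 * cofactor (A x) b a.
apply: (@on_eq_C1 _ _ _ D_open h) => [x Dx|].
  by rewrite /invmx UA // !mxE.
apply: (C1M D_open).
  apply: (C1V D_open); last exact: C1_det.
  by move=> x /UA; rewrite unitmxE unitfE.
rewrite /cofactor; apply: (C1M D_open (C1_cst D_open _)).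
apply: C1_det => c d; apply: (on_eq_C1 D_open _ (CA (lift b c) (lift a d))).
by move=> x _; rewrite !mxE.
Qed.

End C1_matrices.

Section Metrics.
Variables (R : realType) (n r : nat) (D : set 'rV[R]_n).
Hypothesis D_open : open D.
Implicit Types (g : 'rV[R]_n -> 'M[R]_r) (x : 'rV[R]_n) (i j : 'I_n).

Lemma metric_unitmx g x : riemannian_metric D g -> D x -> g x \in unitmx.
Proof.
move=> mg Dx; rewrite unitmxE unitfE; apply/negP => /det0P[v v0 vg].
have [_ /(_ v v0)] := mg x Dx.
by rewrite vg mul0mx mxE ltxx.
Qed.

Lemma C2_metric_C1 g : C2_metric D g -> C1_mx D g.
Proof.
move=> [_ Cg] a b x Dx; have [c H] := Cg a b; split; first exact: c.
by move=> i; have [dg [cg _]] := H i; split; [exact: dg|exact: cg].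
Qed.

Lemma C2_metric_dmx_C1 g j : C2_metric D g -> C1_mx D (dmx j g).
Proof.
move=> [_ Cg] a b; apply: (@on_eq_C1 _ _ _ D_open (pd j (fun z => g z a b))).
  by move=> y _; rewrite mxE.
move=> x Dx; have [_ /(_ j)[_ [cg H]]] := Cg a b; split; first exact: cg.
by move=> i; have [dg cdg] := H i; split; [exact: dg|exact: cdg].
Qed.

Lemma C2_metric_inv_C1 g : C2_metric D g -> C1_mx D (fun x => invmx (g x)).
Proof.
move=> Cg; apply: (C1_invmx D_open); last exact: C2_metric_C1.
by move=> x; apply: metric_unitmx; case: Cg.
Qed.

Definition lowered_curv g i j x : 'M[R]_r :=
  dmx i (dmx j g) x - dmx i g x *m invmx (g x) *m dmx j g x.

(** Differentiate d_j g = g (g^-1 d_j g) in direction i by the product rule and solve for the term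
    in which g is left undifferentiated. *)
Lemma mul_curv_coef g i j x : C2_metric D g -> D x ->
  g x *m curv_coef g i j x = lowered_curv g i j x.
Proof.
rewrite /lowered_curv.
move=> Cg Dx.
have C1g := C2_metric_C1 Cg; have C1dg := C2_metric_dmx_C1 j Cg.
have C1H := C1_mxM D_open (C2_metric_inv_C1 Cg) C1dg.
have /(on_eq_dmx D_open i) -> // : forall y, D y -> dmx j g y =
    g y *m (invmx (g y) *m dmx j g y).
  by move=> y Dy; rewrite mulKVmx // (@metric_unitmx g) //; case: Cg.
by rewrite (dmxM D_open i C1g C1H Dx) mulmxA addrAC subrr add0r.
Qed.

Lemma dmx_sym g i x : (forall y, D y -> (g y)^T = g y) -> D x ->
  (dmx i g x)^T = dmx i g x.
Proof.
move=> gs Dx; apply/matrixP => a b; rewrite !mxE.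
by apply: (on_eq_pd D_open i _ Dx) => y Dy; rewrite -{1}(gs y Dy) mxE.
Qed.

End Metrics.

(** * Grid averages of divergences *)

Section Boxes.
Variables (R : realType) (n : nat).
Implicit Types (x y a : 'rV[R]_n) (l : R) (i : 'I_n).

Definition box a l : set 'rV[R]_n :=
  [set x | forall i, a 0 i <= x 0 i <= a 0 i + l].

Lemma compact_box a l : compact (box a l).
Proof.
have ci i : compact `[a 0 i, a 0 i + l]%classic by exact: segment_compact.
have H := @rV_compact _ n (fun i => `[a 0 i, a 0 i + l]%classic) ci.
suff -> : box a l = [set v : 'rV[R]_n |
    forall i, `[a 0 i, a 0 i + l]%classic (v ord0 i)] by [].
apply/seteqP; split => x /= bx i; have := bx i; rewrite /= in_itv /=; exact.
Qed.

Lemma nbhs_coord x (P : set 'rV[R]_n) : nbhs x P ->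
  exists2 e : R, 0 < e & forall y, (forall i, `|y 0 i - x 0 i| < e) -> P y.
Proof.
move=> /nbhs_ballP[e /= e0 eP]; exists e => // y xy; apply: eP; split=> //.
by move=> i j; rewrite ord1 /ball /= distrC; exact: xy.
Qed.

Lemma coord_nbhs x (e : R) : 0 < e ->
  \forall y \near x, forall i, `|(y : 'rV[R]_n) 0 i - x 0 i| < e.
Proof.
move=> e0; apply/nbhs_ballP; exists e => //= y [_ xy] i.
by have := xy 0 i; rewrite /ball /= distrC.
Qed.

(** Stated for all large [B] instead of some [B], so that finitely many bounds can later be met by a
    single constant. *)
Lemma bounded_on_box a l (f : 'rV[R]_n -> R) :
  (forall x, box a l x -> {for x, continuous f}) ->
  \forall B \near +oo, forall x, box a l x -> `|f x| <= B.
Proof.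
move=> cf; have /compact_near_coveringP := @compact_box a l.
move=> /(_ R (pinfty_nbhs R) (fun B x => `|f x| <= B)); apply => x bx.
have /cvgr_dist_lt /(_ 1 ltr01) fx := cf x bx.
exists ([set y | `|f x - f y| < 1], [set B | `|f x| + 1 < B]).
  by split => //=; exact: nbhs_pinfty_gt.
move=> [y B] /= [fxy fB]; apply: ltW; apply: le_lt_trans fB.
rewrite -[f y](subrK (f x)) addrC (le_trans (ler_normD _ _)) // lerD2l distrC.
exact: ltW.
Qed.

(** Heine-Cantor by compactness: if f varies by less than e / 2 within distance u of x, then every
    point within u / 2 of x admits any modulus below u / 2. *)
Lemma unif_continuous_on_box a l (f : 'rV[R]_n -> R) (e : R) : 0 < e ->
  (forall x, box a l x -> {for x, continuous f}) ->
  exists2 d : R, 0 < d & forall x, box a l x ->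
    forall y, (forall i, `|y 0 i - x 0 i| < d) -> `|f y - f x| < e.
Proof.
move=> e0 cf; have /compact_near_coveringP := @compact_box a l.
move=> /(_ R (0^'+) (fun d x => forall y, (forall i, `|y 0 i - x 0 i| < d) ->
  `|f y - f x| < e)) near_cov.
suff cov : \forall d \near 0^'+, box a l `<=` (fun x => forall y,
    (forall i, `|y 0 i - x 0 i| < d) -> `|f y - f x| < e).
  near (0 : R)^'+ => d; exists d; first by near: d; exact: nbhs_right_gt.
  move=> x bx; exact: (near cov d).
apply: near_cov => x bx.
have e20 : 0 < e / 2 by rewrite divr_gt0.
have /cvgr_dist_lt /(_ _ e20) /nbhs_coord[u u0 fu] := cf x bx.
have u20 : 0 < u / 2 by rewrite divr_gt0.
exists ([set x' : 'rV[R]_n | forall i, `|x' 0 i - x 0 i| < u / 2], [set d | d < u / 2]).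
  by split => /=; [exact: coord_nbhs|exact: nbhs_right_lt].
move=> [x' d] /= [xx' du] y yx'.
have fy := fu y; have fx' := fu x'.
rewrite [ltRHS](splitr e) -(subrK (f x) (f y)) -addrA (le_lt_trans (ler_normD _ _)) // ltrD //.
  rewrite distrC; apply: fy => i; rewrite -(subrK (x' 0 i) (y 0 i)) -addrA.
  by rewrite [ltRHS](splitr u) (le_lt_trans (ler_normD _ _)) // ltrD // (lt_trans _ du).
by apply: fx' => i; rewrite (lt_trans (xx' i)) // ltr_pdivrMr // ltr_pMr // ltr1n.
Unshelve. all: by end_near. Qed.

End Boxes.

Section Grid_average.
Variables (R : realType) (n : nat) (D : set 'rV[R]_n).
Hypothesis D_open : open D.
Variables (a : 'rV[R]_n) (l : R).
Hypotheses (l_gt0 : 0 < l) (box_sub : box a l `<=` D).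
Implicit Types (x : 'rV[R]_n) (i : 'I_n).

(** These are the lower corners of the N^n cells, so no grid point lies on an upper face; each index
    is then cyclic modulo N. *)
Definition grid_pt N (k : {ffun 'I_n -> 'I_N}) : 'rV[R]_n :=
  \row_i (a 0 i + l * ((k i)%:R / N%:R)).

Lemma grid_pt_in N (k : {ffun 'I_n -> 'I_N}) : box a l (grid_pt k).
Proof.
move=> i; rewrite mxE; have N0 : (0 < N)%N := leq_ltn_trans (leq0n _) (ltn_ord (k i)).
rewrite lerDl lerD2l ger_pMr //; apply/andP; split.
  by rewrite mulr_ge0 ?divr_ge0 // ltW.
by rewrite ler_pdivrMr ?ltr0n // mul1r ler_nat ltnW.
Qed.

Lemma grid_step N k : l / N%:R + l * (k%:R / N%:R) = l * (k.+1%:R / N%:R).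
Proof. by rewrite -mulrDr -[X in l * (X + _)]mul1r -mulrDl -natr1 (addrC 1). Qed.

Lemma derivable_line (f : 'rV[R]_n -> R) i x (t : R) :
  derivable f (t *: coord_vec R i + x) (coord_vec R i) ->
  is_derive t (1 : R) (fun s : R => f (s *: coord_vec R i + x))
    (pd i f (t *: coord_vec R i + x)).
Proof.
have E : (fun h : R => h^-1 *: (((fun s : R => f (s *: coord_vec R i + x)) \o shift t)
   (h *: (1 : R)) - f (t *: coord_vec R i + x))) =
   (fun h : R => h^-1 *: ((f \o shift (t *: coord_vec R i + x)) (h *: coord_vec R i)
   - f (t *: coord_vec R i + x))).
  apply/funext => h /=; congr (_ *: (f _ - _)).
  by rewrite [h *: 1]mulr1 scalerDl addrA.
move=> df; apply: DeriveDef; first by rewrite /derivable E.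
by rewrite /derive E.
Qed.

(** The mean value theorem on a segment parallel to an axis. *)
Lemma difference_quotient (f : 'rV[R]_n -> R) i x (h : R) : C1_on D f -> 0 < h ->
  (forall t, 0 <= t <= h -> D (t *: coord_vec R i + x)) ->
  exists2 t, 0 < t < h &
    f (h *: coord_vec R i + x) - f x = pd i f (t *: coord_vec R i + x) * h.
Proof.
move=> Cf h0 lineD.
have der t : 0 <= t <= h -> is_derive t (1 : R) (fun s : R => f (s *: coord_vec R i + x))
    (pd i f (t *: coord_vec R i + x)).
  by move=> th; apply: derivable_line; apply: (C1_derivable Cf); exact: lineD.
have [| |t] := @MVT R (fun s : R => f (s *: coord_vec R i + x))
    (fun t => pd i f (t *: coord_vec R i + x)) 0 h h0.
- by move=> t; rewrite in_itv /= => /andP[t0 th]; apply: der; rewrite !ltW.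
- apply: derivable_within_continuous => t; rewrite in_itv /= => tin.
  by have := der t tin; case.
- rewrite in_itv /= => tin; rewrite scale0r add0r subr0 => E.
  by exists t.
Qed.

(* Shifting the i-th grid index cyclically is a translation by one step,
   except across the two opposite faces, on which f vanishes. *)
Lemma grid_shift_sum (f : 'rV[R]_n -> R) i N :
  (forall x, box a l x -> x 0 i = a 0 i \/ x 0 i = a 0 i + l -> f x = 0) ->
  \sum_(k : {ffun 'I_n -> 'I_N}) f ((l / N%:R) *: coord_vec R i + grid_pt k) =
  \sum_(k : {ffun 'I_n -> 'I_N}) f (grid_pt k).
Proof.
move=> f0.
pose sh (k : {ffun 'I_n -> 'I_N}) : {ffun 'I_n -> 'I_N} :=
  [ffun j => if j == i then ordS (k j) else k j].
have sh_inj : injective sh.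
  move=> k k' /ffunP kk'; apply/ffunP => j; have := kk' j; rewrite !ffunE.
  by case: ifP => // _ /ordS_inj.
rewrite [RHS](reindex_inj sh_inj); apply: eq_bigr => k _ /=.
have N0 : (0 < N)%N := leq_ltn_trans (leq0n _) (ltn_ord (k i)).
have N0R : (N%:R : R) != 0 by rewrite pnatr_eq0 -lt0n.
have := ltn_ord (k i); rewrite leq_eqVlt => /orP[/eqP kN|kN].
- rewrite !f0 //.
  + exact: grid_pt_in.
  + by left; rewrite mxE ffunE eqxx /= kN modnn mul0r mulr0 addr0.
  + move=> j; rewrite !mxE eqxx /=.
    have [->|ji] := eqVneq j i; last first.
      by rewrite mulr0 add0r; have := grid_pt_in k j; rewrite mxE.
    rewrite mulr1 addrCA grid_step kN divff // mulr1 lexx lerDl andbT.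
    exact: ltW.
  + by right; rewrite !mxE !eqxx /= mulr1 addrCA grid_step kN divff // mulr1.
- congr f; apply/rowP => j; rewrite !mxE ffunE eqxx /=.
  have [->|ji] := eqVneq j i; last by rewrite mulr0 add0r.
  by rewrite mulr1 /= modn_small // addrCA grid_step.
Qed.

(** By the mean value theorem and uniform continuity, for large N the derivative at a grid point
    exceeds the difference quotient of step l / N by at most e. The difference quotients sum to 0 by
    [grid_shift_sum], and there are N^n grid points. *)
Lemma grid_average_pd (f : 'rV[R]_n -> R) i (e : R) : 0 < e -> C1_on D f ->
  (forall x, box a l x -> x 0 i = a 0 i \/ x 0 i = a 0 i + l -> f x = 0) ->
  \forall N \near \oo,
    \sum_(k : {ffun 'I_n -> 'I_N}) pd i f (grid_pt k) <= e * N%:R ^+ n.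
Proof.
move=> e0 Cf f0.
have [d d0 uc] : exists2 d : R, 0 < d & forall x, box a l x ->
    forall y : 'rV[R]_n, (forall j, `|y 0 j - x 0 j| < d) -> `|pd i f y - pd i f x| < e.
  apply: unif_continuous_on_box => // x /box_sub Dx.
  exact: C1_pd_continuous Cf Dx i.
near=> N.
have N0 : (0 < N)%N by near: N; exact: nbhs_infty_gt.
have N0R : 0 < N%:R :> R by rewrite ltr0n.
set h := l / N%:R.
have h0 : 0 < h by rewrite divr_gt0.
have hd : h < d.
  by rewrite ltr_pdivrMr // -ltr_pdivrMl //; near: N; exact: nbhs_infty_gtr.
have step k : pd i f (grid_pt k) <=
    e + h^-1 * (f (h *: coord_vec R i + @grid_pt N k) - f (grid_pt k)).
  have in_box t : 0 <= t <= h -> box a l (t *: coord_vec R i + grid_pt k).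
    move=> /andP[t0 th] j; rewrite !mxE eqxx /=.
    have /andP[gl gr] := grid_pt_in k j; rewrite mxE in gl gr.
    have [->|ji] := eqVneq j i; last by rewrite mulr0 add0r gl gr.
    rewrite mulr1 addrCA lerDl addr_ge0 //=; last first.
      by rewrite mulr_ge0 ?divr_ge0 // ltW.
    rewrite lerD2l (le_trans (lerD th (lexx _))) // /h grid_step.
    by rewrite ger_pMr // ler_pdivrMr // mul1r ler_nat.
  have [t /andP[t0 th] ->] := difference_quotient Cf h0 (fun t th => box_sub (in_box t th)).
  rewrite mulrCA mulVf ?gt_eqF // mulr1 -lerBlDr ltW //.
  rewrite (le_lt_trans (ler_norm _)) // distrC; apply: uc; first exact: grid_pt_in.
  move=> j; rewrite !mxE eqxx /= addrK.
  have [_|_] := eqVneq j i; last by rewrite mulr0 normr0.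
  by rewrite mulr1 gtr0_norm // (lt_trans th).
apply: (le_trans (ler_sum _ (fun k _ => step k))).
rewrite big_split /= -mulr_sumr sumrB (@grid_shift_sum f i N f0) subrr mulr0 addr0.
by rewrite sumr_const card_ffun !card_ord -[e *+ _]mulr_natr natrX.
Unshelve. all: by end_near. Qed.

(** A polynomial cut-off: each factor 4 t (1 - t) vanishes at both ends of [0, 1] and has maximum 1
    at the middle. *)
Definition bump x : R :=
  \prod_(i < n) (4 * ((x 0 i - a 0 i) / l) * (1 - (x 0 i - a 0 i) / l)).

Lemma bump_C1 : C1_on D bump.
Proof.
have C1t i : C1_on D (fun x => (x 0 i - a 0 i) / l).
  apply: (C1M D_open _ (C1_cst D_open _)).
  exact: (C1D D_open (C1_coord D_open i) (C1_cst D_open _)).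
apply: C1_prod => // i; apply: (C1M D_open).
  exact: (C1M D_open (C1_cst D_open _) (C1t i)).
exact: (C1D D_open (C1_cst D_open _) (C1N D_open (C1t i))).
Qed.

Lemma bump_face x i : x 0 i = a 0 i \/ x 0 i = a 0 i + l -> bump x = 0.
Proof.
move=> xi; apply/eqP; rewrite prodf_seq_eq0; apply/hasP; exists i => /=.
  by rewrite mem_index_enum.
case: xi => ->; first by rewrite subrr mul0r mulr0 mul0r.
by rewrite (addrC (a 0 i)) addrK divff ?lt0r_neq0 // subrr mulr0.
Qed.

Lemma bump_ge0_le1 x : box a l x -> 0 <= bump x <= 1.
Proof.
move=> bx; apply/andP; split.
  apply: prodr_ge0 => i _; have /andP[xl xr] := bx i.
  rewrite !mulr_ge0 ?subr_ge0 ?invr_ge0 ?(ltW l_gt0) //.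
  by rewrite ler_pdivrMr // mul1r lerBlDl.
rewrite -[leRHS](@expr1n R n) -[in leRHS](card_ord n) -prodr_const.
apply: ler_prod => i _; have /andP[xl xr] := bx i.
set t := _ / l.
have t01 : 0 <= t <= 1.
  by rewrite divr_ge0 ?subr_ge0 ?(ltW l_gt0) // ler_pdivrMr // mul1r lerBlDl.
(* This square is 1 - 4 t (1 - t). *)
have := sqr_ge0 (2 * t - 1); move: t01 => /andP[t0 t1] sq.
by apply/andP; split; nra.
Qed.

(** From (y - 1/2)^2 >= 0 one gets y^2 >= y - 1/4, which reduces the claim to the sum of the y
    themselves, namely 2/3 (N - 1/N). This is at least N / 2 as soon as N >= 2. *)
Lemma sum_logistic_sqr N : (1 < N)%N ->
  1 / 4 * N%:R <= \sum_(k < N) (4 * (k%:R / N%:R) * (1 - k%:R / N%:R)) ^+ 2 :> R.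
Proof.
move=> N1; have N0 : (N%:R : R) != 0 by rewrite pnatr_eq0 -lt0n ltnW.
(* The upper limit [M] is kept apart from [N] so that the summand stays fixed during the
   induction. *)
have lin M : \sum_(k < M) (6 * (k%:R * (N%:R - k%:R))) =
    3 * N%:R * M%:R * (M%:R - 1) - M%:R * (M%:R - 1) * (2 * M%:R - 1) :> R.
  elim: M => [|M IH]; first by rewrite big_ord0 !mulr0 !mul0r subrr.
  by rewrite big_ord_recr /= IH -natr1; ring.
have -> : 1 / 4 * N%:R = N%:R / 2 - N%:R / 4 :> R by field.
apply: (@le_trans _ _ (\sum_(k < N) (4 * (k%:R / N%:R) * (1 - k%:R / N%:R) - 1 / 4))).
  rewrite sumrB sumr_const card_ord -[(1 / 4) *+ N]mulr_natr.
  have -> : \sum_(k < N) (4 * (k%:R / N%:R) * (1 - k%:R / N%:R)) =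
      2 / 3 * N%:R ^- 2 * (N%:R ^+ 3 - N%:R) :> R.
    have -> : N%:R ^+ 3 - N%:R = \sum_(k < N) (6 * (k%:R * (N%:R - k%:R))) :> R.
      by rewrite lin; ring.
    by rewrite mulr_sumr; apply: eq_bigr => k _; field.
  have N2 : 2 <= N%:R :> R by rewrite ler_nat.
  have -> : 2 / 3 * N%:R ^- 2 * (N%:R ^+ 3 - N%:R) = 2 / 3 * (N%:R - N%:R^-1) :> R.
    by field.
  have NV : N%:R^-1 <= 1 / 2 :> R.
    by rewrite ler_pdivlMr // ler_pdivrMl ?mulr1 // (lt_le_trans _ N2).
  lra.
apply: ler_sum => k _; set y := 4 * _ * _.
by have := sqr_ge0 (y - 1 / 2); nra.
Qed.

(** The bump is a product of one-variable factors, so its sum over the grid splits into a product of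
    n one-dimensional sums. *)
Lemma grid_bump_sum N : (1 < N)%N ->
  (1 / 4) ^+ n * N%:R ^+ n <= \sum_(k : {ffun 'I_n -> 'I_N}) bump (grid_pt k) ^+ 2.
Proof.
move=> N1.
pose u (k : 'I_N) : R := (4 * (k%:R / N%:R) * (1 - k%:R / N%:R)) ^+ 2.
have -> : \sum_(k : {ffun 'I_n -> 'I_N}) bump (grid_pt k) ^+ 2 =
    \prod_(i < n) \sum_(k < N) u k.
  rewrite bigA_distr_bigA; apply: eq_bigr => k _; rewrite -prodrXl.
  apply: eq_bigr => i _; rewrite /u !mxE addrAC subrr add0r.
  by rewrite [l * _]mulrC mulfK ?gt_eqF.
rewrite -exprMn -[in leLHS](card_ord n) -prodr_const; apply: ler_prod => i _.
by rewrite mulr_ge0 //= sum_logistic_sqr.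
Qed.

(** Sum the pointwise inequality over the grid and divide by N^n: the left side keeps at least delta
    / 4^n, while the divergence contributes at most an arbitrary e > 0. *)
Lemma bump_not_divergence (F : 'I_n -> 'rV[R]_n -> R) (delta tau : R) :
  0 <= delta -> (forall i, C1_on D (F i)) ->
  (forall i x, box a l x -> x 0 i = a 0 i \/ x 0 i = a 0 i + l -> F i x = 0) ->
  (forall x, box a l x -> delta * bump x ^+ 2 <= \sum_(i < n) pd i (F i) x + tau) ->
  delta * (1 / 4) ^+ n <= tau.
Proof.
move=> delta0 CF F0 le_div; apply/ler_addgt0Pr => e e0.
(* With n + 1 in the denominator the n directional errors add up to at most e, including when n =
   0. *)
have e1 : 0 < e / n.+1%:R by rewrite divr_gt0.
have avg : \forall N \near \oo, forall i,
    \sum_(k : {ffun 'I_n -> 'I_N}) pd i (F i) (grid_pt k) <= e / n.+1%:R * N%:R ^+ n.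
  apply: filter_forall => i; exact: grid_average_pd e1 (CF i) (F0 i).
near \oo => N.
have N1 : (1 < N)%N by near: N; exact: nbhs_infty_gt.
have Nn : 0 < N%:R ^+ n :> R by rewrite exprn_gt0 // ltr0n ltnW.
rewrite -(ler_pM2r Nn) -mulrA.
apply: (le_trans (ler_wpM2l delta0 (grid_bump_sum N1))); rewrite mulr_sumr.
apply: (le_trans (ler_sum _ (fun k _ => le_div _ (grid_pt_in k)))).
rewrite big_split /= sumr_const card_ffun !card_ord exchange_big /=.
rewrite -[tau *+ _]mulr_natr natrX mulrDl addrC lerD2l.
apply: (@le_trans _ _ (\sum_(i < n) (e / n.+1%:R * N%:R ^+ n))).
  apply: ler_sum => i _; move: i; near: N; exact: avg.
rewrite sumr_const card_ord -[_ *+ n]mulr_natl mulrA ler_pM2r // mulrCA ger_pMr //.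
by rewrite ler_pdivrMr // mul1r ler_nat.
Unshelve. all: by end_near. Qed.

End Grid_average.

(** * Positive semidefinite matrices and the trace inequality *)

Section Positive_semidefinite.
Variables (R : realType) (r : nat).
Implicit Types (A P W G : 'M[R]_r) (v : 'rV[R]_r).

(** [mx_le A B] is [psd (B - A)] by conversion, so the monotonicity hypotheses apply directly as
    statements about [psd]. *)
Definition psd P : Prop := forall v, 0 <= (v *m P *m v^T) 0 0.

Lemma mulmx_quadratic_delta P a b :
  ((delta_mx 0 a : 'rV[R]_r) *m P *m (delta_mx 0 b : 'rV[R]_r)^T) 0 0 = P a b.
Proof. by rewrite -rowE trmx_delta -colE !mxE. Qed.

Lemma psd_diag P a : psd P -> 0 <= P a a.
Proof. by move=> /(_ (delta_mx 0 a)); rewrite mulmx_quadratic_delta. Qed.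

Let trmx_add (u v : 'rV[R]_r) : (u + v)^T = u^T + v^T.
Proof. by apply/matrixP => s t; rewrite !mxE. Qed.

Let trmx_sub (u v : 'rV[R]_r) : (u - v)^T = u^T - v^T.
Proof. by apply/matrixP => s t; rewrite !mxE. Qed.

Let entry_add (X Y : 'M[R]_1) : (X + Y) 0 0 = X 0 0 + Y 0 0.
Proof. by rewrite mxE. Qed.

Let entry_opp (X : 'M[R]_1) : (- X) 0 0 = - X 0 0.
Proof. by rewrite mxE. Qed.

(** Evaluate the quadratic form on the sum and on the difference of the basis vectors a and b. *)
Lemma psd_entry P a b : psd P -> P^T = P -> `|P a b| <= (P a a + P b b) / 2.
Proof.
move=> pP sP; have Pba : P b a = P a b by rewrite -{1}sP mxE.
have := pP (delta_mx 0 a + delta_mx 0 b); have := pP (delta_mx 0 a - delta_mx 0 b).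
rewrite trmx_sub trmx_add !(mulmxDl, mulmxDr, mulNmx, mulmxN).
rewrite !(entry_add, entry_opp) !mulmx_quadratic_delta Pba ler_norml => h1 h2.
by apply/andP; split; lra.
Qed.

Lemma psd_entry_trace P a b : psd P -> P^T = P -> `|P a b| <= \tr P.
Proof.
move=> pP sP; apply: (le_trans (psd_entry a b pP sP)).
have le_tr c : P c c <= \tr P.
  rewrite /mxtrace (bigD1 c) //= lerDl; apply: sumr_ge0 => k _; exact: psd_diag.
have := le_tr a; have := le_tr b; lra.
Qed.

(** The off-diagonal entries of [P] are at most the means of two diagonal ones; summing these means
    over all pairs gives r times the trace. *)
Lemma trace_mul_psd_le W P (e : R) : psd P -> P^T = P ->
  (forall a b, `|W a b| <= e) -> \tr (W *m P) <= e * r%:R * \tr P.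
Proof.
move=> pP sP We.
apply: (@le_trans _ _ (\sum_(a < r) \sum_(b < r) e * ((P b b + P a a) / 2))).
  apply: ler_sum => a _; rewrite mxE; apply: ler_sum => b _.
  apply: (le_trans (ler_norm _)); rewrite normrM.
  by apply: ler_pM => //; exact: psd_entry.
have -> : \sum_(a < r) \sum_(b < r) e * ((P b b + P a a) / 2) =
    \sum_(a < r) (e / 2 * (\tr P + r%:R * P a a)).
  apply: eq_bigr => a _; rewrite -mulr_sumr -mulr_suml big_split /= sumr_const.
  by rewrite card_ord -[P a a *+ r]mulr_natl -/(mxtrace P); ring.
rewrite -mulr_sumr big_split /= sumr_const card_ord -mulr_sumr -/(mxtrace P).
by rewrite -[_ *+ r]mulr_natl le_eqVlt; apply/orP; left; apply/eqP; field.
Qed.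

Lemma psd_invmx G : G \in unitmx -> G^T = G -> psd G -> psd (invmx G).
Proof.
move=> uG sG pG v; have := pG (v *m invmx G).
by rewrite trmx_mul trmx_inv sG mulmxKV // mulmxA.
Qed.

(* With H = G^-1 and H0 = G0^-1, expanding the nonnegative quantity
   (H0 - H) G0 (H0 - H) on a basis vector and using G0 <= G gives H <= H0. *)
Lemma invmx_diag_le G0 G a : G0 \in unitmx -> G \in unitmx ->
  G0^T = G0 -> G^T = G -> psd G0 -> psd (G - G0) ->
  (invmx G) a a <= (invmx G0) a a.
Proof.
move=> u0 uG s0 sG p0 pG.
pose e : 'rV[R]_r := delta_mx 0 a.
have HT : (invmx G)^T = invmx G by rewrite trmx_inv sG.
have H0T : (invmx G0)^T = invmx G0 by rewrite trmx_inv s0.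
have := p0 (e *m invmx G0 - e *m invmx G); have := pG (e *m invmx G).
rewrite !trmx_sub !trmx_mul HT H0T.
rewrite !(mulmxDl, mulmxDr, mulNmx, mulmxN) !mulmxA !(entry_add, entry_opp).
rewrite !(mulmxKV u0) !(mulmxKV uG) -!(mulmxA _ G0 (invmx G0)) (mulmxV u0) !mulmx1.
rewrite !mulmx_quadratic_delta; lra.
Qed.

(** The bound depends on [G0] only. Applied with [G0] the first metric of the sequence, it controls
    all inverses g_m^-1 at once. *)
Lemma invmx_entry_le G0 G a b : G0 \in unitmx -> G \in unitmx ->
  G0^T = G0 -> G^T = G -> psd G0 -> psd (G - G0) ->
  `|(invmx G) a b| <= \tr (invmx G0).
Proof.
move=> u0 uG s0 sG p0 pG.
have psdG : psd G.
  by move=> v; rewrite -(subrK G0 G) mulmxDr mulmxDl mxE addr_ge0.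
apply: (@le_trans _ _ (\tr (invmx G))).
  by apply: psd_entry_trace; [exact: psd_invmx|rewrite trmx_inv sG].
by apply: ler_sum => k _; exact: invmx_diag_le.
Qed.

End Positive_semidefinite.

Section Nakano_trace.
Variables (R : realType) (n r q : nat).
Implicit Types (G : 'M[R]_r) (alpha beta : Defs.form R n r) (x : 'rV[R]_n)
  (g : 'rV[R]_n -> 'M[R]_r) (i j k : 'I_n) (I K : {set 'I_n}).

(** These are the matrices C_ij; they depend on the form alone, hence are shared by g and all the
    g_m. *)
Definition form_tensor alpha i j : 'M[R]_r :=
  \matrix_(s, xi) \sum_(K : {set 'I_n} | #|K| == q)
    \sum_(I : {set 'I_n} | #|I| == q) wedge_contr R I i j K * (alpha I s * alpha K xi).

Lemma form_inner_sum G (a : 'I_n -> Defs.form R n r) beta :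
  form_inner q G (fun K tau => \sum_i a i K tau) beta =
  \sum_i form_inner q G (a i) beta.
Proof.
rewrite /form_inner [RHS]exchange_big; apply: eq_bigr => K _ /=.
rewrite [RHS]exchange_big; apply: eq_bigr => tau _ /=.
by rewrite [RHS]exchange_big; apply: eq_bigr => xi _ /=; rewrite !mulr_suml.
Qed.

Lemma form_inner_opp G (a : Defs.form R n r) beta :
  form_inner q G (fun K tau => - a K tau) beta = - form_inner q G a beta.
Proof.
rewrite /form_inner -sumrN; apply: eq_bigr => K _.
rewrite -sumrN; apply: eq_bigr => tau _.
by rewrite -sumrN; apply: eq_bigr => xi _; rewrite !mulNr.
Qed.

(** Exchange the finite sums: by symmetry of g, the sum over tau lowers the index of the curvature
    coefficient, and the sums over I and K assemble [form_tensor]. *)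
Lemma form_inner_Theta D g x alpha : open D -> C2_metric D g -> D x ->
  form_inner q (g x) (Theta g q x alpha) alpha =
  - \sum_i \sum_j \tr (lowered_curv g i j x *m form_tensor alpha i j).
Proof.
move=> D_open Cg Dx; have sg : (g x)^T = g x by case: Cg => mg _; case: (mg x Dx).
rewrite /Theta form_inner_opp form_inner_sum; congr (- _).
apply: eq_bigr => i _; rewrite form_inner_sum; apply: eq_bigr => j _.
rewrite -(mul_curv_coef D_open i j Cg Dx) /form_inner /mxtrace.
under eq_bigr do rewrite exchange_big /=.
rewrite exchange_big /=; apply: eq_bigr => xi _.
rewrite mxE; under [RHS]eq_bigr do rewrite !mxE.
under [RHS]eq_bigr => s _ do rewrite mulr_sumr.
rewrite [RHS]exchange_big /=; apply: eq_bigr => K _.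
transitivity (\sum_s \sum_tau \sum_(I : {set 'I_n} | #|I| == q)
   g x xi tau * curv_coef g i j x tau s *
   (wedge_contr R I i j K * (alpha I s * alpha K xi))).
  rewrite exchange_big /=; apply: eq_bigr => tau _.
  rewrite -mulrA mulr_suml exchange_big /=; apply: eq_bigr => I _.
  rewrite !mulr_sumr mulr_suml; apply: eq_bigr => s _.
  by have -> : g x tau xi = g x xi tau by [rewrite -{1}sg mxE]; ring.
apply: eq_bigr => s _; rewrite mulr_suml; apply: eq_bigr => tau _.
by rewrite mulr_sumr.
Qed.

(** Contracting with j and wedging with i returns to the same set only if i = j lies in it; the two
    sign exponents then agree and the sign is +1. *)
Lemma wedge_contr_diag I i j :
  wedge_contr R I i j I = ((i == j) && (i \in I))%:R.
Proof.
rewrite /wedge_contr; have [<-|ij] := eqVneq i j; last first.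
  rewrite /=; case: ifP => // /and3P[jI _ /eqP /setP /(_ j)].
  by rewrite jI !inE eqxx /= eq_sym (negbTE ij).
have [iI|//] := boolP (i \in I) => /=.
rewrite !inE eqxx /= finset.setUC finset.setD1K // eqxx.
have -> : [set k in I :\ i | (k < i)%N] = [set k in I | (k < i)%N].
  apply/setP => k; rewrite !inE.
  by have [->|] := eqVneq k i; rewrite ?ltnn ?andbF.
by rewrite addnn -mul2n exprM sqrrN !expr1n.
Qed.

(** The transposition of i and j maps one family bijectively onto the other. *)
Lemma card_sets_through i j :
  #|[set I : {set 'I_n} | (#|I| == q) && (i \in I)]%SET| =
  #|[set I : {set 'I_n} | (#|I| == q) && (j \in I)]%SET|.
Proof.
pose t := tperm i j.
rewrite -(card_imset _ (imset_inj (@perm_inj _ t))); apply: eq_card => J.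
rewrite [RHS]inE; apply/imsetP/idP => [[I]|/andP[qJ jJ]].
  rewrite inE => /andP[qI iI] ->; rewrite card_imset ?qI; last exact: perm_inj.
  by apply/imsetP; exists i => //; rewrite tpermL.
exists (t @: J); last first.
  by rewrite -imset_comp -[LHS]imset_id; apply: eq_imset => k /=; rewrite tpermK.
rewrite inE card_imset ?qJ; last exact: perm_inj.
by apply/imsetP; exists j => //; rewrite tpermR.
Qed.

Lemma card_sets_through_gt0 i : (1 <= q <= n)%N ->
  (0 < #|[set I : {set 'I_n} | (#|I| == q) && (i \in I)]%SET|)%N.
Proof.
move=> /andP[q1 qn].
have /card_gt0P[J] : (0 < #|[set I : {set 'I_n} | #|I| == q]%SET|)%N.
  by rewrite card_draws card_ord bin_gt0.
rewrite inE => qJ; have /card_gt0P[j jJ] : (0 < #|J|)%N by rewrite (eqP qJ).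
by rewrite (card_sets_through i j) (cardD1 J) inE qJ jJ.
Qed.

(* Summing the inequality over the forms dx_I (x) v with |I| = q counts each
   direction equally often. *)
Lemma nakano_trace D g x (v : 'rV[R]_r) : open D -> (1 <= q <= n)%N -> C2_metric D g ->
  nakano_q_semipositive D q g -> D x ->
  0 <= - \sum_i (v *m lowered_curv g i i x *m v^T) 0 0.
Proof.
move=> D_open qn Cg Ng Dx.
set y := fun i => (v *m lowered_curv g i i x *m v^T) 0 0.
(* Test on the form dx_I0 (x) v: its tensor vanishes off the diagonal and is v^T v for i = j in
   I0. *)
have per_set I0 : #|I0| == q -> 0 <= - \sum_i (i \in I0)%:R * y i.
  move=> qI0.
  have := Ng x Dx (fun I tau => (I == I0)%:R * v 0 tau).
  rewrite (form_inner_Theta _ D_open Cg Dx); congr (0 <= - _); apply: eq_bigr => i _.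
  have tensor j : form_tensor (fun I tau => (I == I0)%:R * v 0 tau) i j =
      ((i == j) && (i \in I0))%:R *: (v^T *m v).
    apply/matrixP => s xi; rewrite !mxE big_ord1 !mxE.
    rewrite (bigD1 I0) //= (bigD1 I0) //= eqxx !big1 ?addr0.
    - by rewrite wedge_contr_diag !mul1r.
    - move=> K /andP[_ /negbTE KI]; rewrite big1 // => I _.
      by rewrite KI mul0r !mulr0.
    - by move=> I /andP[_ /negbTE ->]; rewrite !mul0r mulr0.
  rewrite (bigD1 i) //= big1 ?addr0 => [|j /negbTE ji].
    rewrite tensor eqxx /= -scalemxAr mxtraceZ; congr (_ * _).
    by rewrite mulmxA mxtrace_mulC mulmxA trace_mx11.
  by rewrite tensor eq_sym ji scale0r mulmx0 mxtrace0.
(* The multiplicity of direction i in the sum over all sets; it is positive and independent of i, so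
   it can be divided out. *)
pose c i := #|[set I : {set 'I_n} | (#|I| == q) && (i \in I)]%SET|.
have : 0 <= \sum_(I : {set 'I_n} | #|I| == q) - \sum_i (i \in I)%:R * y i.
  exact: sumr_ge0.
rewrite sumrN exchange_big /=.
have -> : \sum_i \sum_(I : {set 'I_n} | #|I| == q) (i \in I)%:R * y i =
    \sum_i (c i)%:R * y i.
  apply: eq_bigr => i _; rewrite -mulr_suml; congr (_ * _).
  rewrite /c -sum1_card natr_sum big_mkcond [RHS]big_mkcond.
  by apply: eq_bigr => I _; rewrite inE; case: eqP; case: (i \in I).
rewrite !oppr_ge0; have [[i0]|n0] := pselect (exists i : 'I_n, True); last first.
  by move=> _; rewrite big1 // => i _; case: n0; exists i.
have -> : \sum_i (c i)%:R * y i = (c i0)%:R * \sum_i y i.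
  by rewrite mulr_sumr; apply: eq_bigr => i _; rewrite /c (card_sets_through i i0).
by rewrite pmulr_rle0 // ltr0n card_sets_through_gt0.
Qed.

End Nakano_trace.

(** * Pointwise estimates *)

Section Entry_bounds.
Variables (R : realType) (r : nat).
Implicit Types (A B : 'M[R]_r) (a b : R).

(** A bound in the entrywise maximum norm, which is not submultiplicative: every product costs a
    factor r. *)
Definition entries_le A a : Prop := forall s t, `|A s t| <= a.

Lemma entries_leM A B a b : entries_le A a -> entries_le B b ->
  entries_le (A *m B) (r%:R * a * b).
Proof.
move=> Aa Bb s t; rewrite mxE (le_trans (ler_norm_sum _ _ _)) //.
rewrite -mulrA mulr_natl -[X in _ <= _ *+ X](card_ord r) -sumr_const.
by apply: ler_sum => k _; rewrite normrM ler_pM.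
Qed.

Lemma entries_leD A B a b : entries_le A a -> entries_le B b ->
  entries_le (A + B) (a + b).
Proof. by move=> Aa Bb s t; rewrite mxE (le_trans (ler_normD _ _)) // lerD. Qed.

Lemma entries_leN A a : entries_le A a -> entries_le (- A) a.
Proof. by move=> Aa s t; rewrite mxE normrN. Qed.

Lemma entries_le_sum n (A : 'I_n -> 'M[R]_r) a :
  (forall i, entries_le (A i) a) -> entries_le (\sum_i A i) (n%:R * a).
Proof.
move=> Aa s t; rewrite summxE (le_trans (ler_norm_sum _ _ _)) //.
rewrite mulr_natl -[X in _ <= _ *+ X](card_ord n) -sumr_const.
by apply: ler_sum => k _; exact: Aa.
Qed.

Lemma entries_le_trace A a : entries_le A a -> `|\tr A| <= r%:R * a.
Proof.
move=> Aa; rewrite (le_trans (ler_norm_sum _ _ _)) //.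
rewrite mulr_natl -[X in _ <= _ *+ X](card_ord r) -sumr_const.
by apply: ler_sum => k _; exact: Aa.
Qed.

(** For a symmetric matrix the trace of the square is the sum of the squared entries. *)
Lemma entries_le_sqrt_trace n (E : 'I_n -> 'M[R]_r) i : (forall i, (E i)^T = E i) ->
  entries_le (E i) (Num.sqrt (\sum_i \tr (E i *m E i))).
Proof.
move=> sE s t.
have trE k : \tr (E k *m E k) = \sum_s \sum_t (E k s t) ^+ 2.
  apply: eq_bigr => a _; rewrite mxE; apply: eq_bigr => b _.
  by rewrite expr2 -{2}(sE k) mxE.
rewrite -sqrtr_sqr ler_wsqrtr //.
under eq_bigr do rewrite trE.
rewrite (bigD1 i) //= (bigD1 s) //= (bigD1 t) //= -!addrA lerDl.
by rewrite !addr_ge0 //; do ?[apply: sumr_ge0 => ? _]; rewrite ?sqr_ge0.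
Qed.

End Entry_bounds.

Section Pointwise_estimates.
Variables (R : realType) (n r : nat) (B : R).
Hypothesis B_ge0 : 0 <= B.
Local Notation N := (r%:R : R).

Definition K_quad : R := 2 * N ^+ 4 * B ^+ 3 + N ^+ 4 * B ^+ 2 + N ^+ 6 * B ^+ 5.

Lemma K_quad_ge0 : 0 <= K_quad.
Proof. by rewrite !addr_ge0 ?mulr_ge0 ?exprn_ge0. Qed.

(** Expand Di = di + (Di - di) and likewise Dj, and use G^-1 - g^-1 = - G^-1 (G - g) g^-1. Two of
    the four resulting terms are linear in e, one is quadratic in e and one is linear in eps; they
    yield the three summands of [K_quad]. *)
Lemma quadratic_term_diff (G g Di Dj di dj C : 'M[R]_r) (e eps : R) :
  G \in unitmx -> g \in unitmx ->
  entries_le (invmx G) B -> entries_le (invmx g) B ->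
  entries_le di B -> entries_le dj B -> entries_le C B ->
  entries_le (Di - di) e -> entries_le (Dj - dj) e -> entries_le (G - g) eps ->
  0 <= e -> 0 <= eps ->
  `|\tr ((Di *m invmx G *m Dj - di *m invmx g *m dj) *m C)| <=
  K_quad * (e + e ^+ 2 + eps).
Proof.
move=> uG ug HB hB diB djB CB Ei Ej We e0 eps0.
set H := invmx G; set h := invmx g.
have -> : Di *m H *m Dj - di *m h *m dj =
    (Di - di) *m H *m dj + di *m H *m (Dj - dj) + (Di - di) *m H *m (Dj - dj)
    + - (di *m H *m (G - g) *m h *m dj).
  have -> : di *m H *m (G - g) *m h *m dj = di *m h *m dj - di *m H *m dj.
    rewrite mulmxBr !mulmxBl -!mulmxA (mulmxA H G) mulVmx // mul1mx.
    by rewrite (mulmxA g h) mulmxV // mul1mx.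
  rewrite !(mulmxBl, mulmxBr) opprB.
  apply/matrixP => a b; rewrite !mxE; lra.
have := entries_le_trace (entries_leM (entries_leD (entries_leD (entries_leD
  (entries_leM (entries_leM Ei HB) djB) (entries_leM (entries_leM diB HB) Ej))
  (entries_leM (entries_leM Ei HB) Ej))
  (entries_leN (entries_leM (entries_leM (entries_leM (entries_leM diB HB) We) hB) djB))) CB).
move=> /le_trans; apply; rewrite -subr_ge0 /K_quad.
have -> : (2 * N ^+ 4 * B ^+ 3 + N ^+ 4 * B ^+ 2 + N ^+ 6 * B ^+ 5) * (e + e ^+ 2 + eps)
   - N * (N * (N * (N * e * B) * B + N * (N * B * B) * e + N * (N * e * B) * e
     + N * (N * (N * (N * B * B) * eps) * B) * B) * B) =
   2 * N ^+ 4 * B ^+ 3 * (e ^+ 2 + eps) + N ^+ 4 * B ^+ 2 * (e + eps)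
   + N ^+ 6 * B ^+ 5 * (e + e ^+ 2) by ring.
by rewrite !addr_ge0 // !mulr_ge0 ?addr_ge0 ?exprn_ge0.
Qed.

End Pointwise_estimates.

Section Absorption.
Variable R : realType.

(* [d1] and [d2] stand for divergences and [e] for the size of the gradient of
   [g_m - g]; AM-GM and the second inequality absorb the terms in [e] into [d2]. *)
Lemma absorb_gradient (K1 K2 tau : R) : 0 <= K1 -> 0 <= K2 -> 0 < tau ->
  exists2 lambda, 0 <= lambda & exists2 eps0, 0 < eps0 &
  forall eps chi e d1 d2 u : R, 0 <= eps <= eps0 -> 0 <= chi <= 1 -> 0 <= e ->
    u <= d1 + K1 * (chi * e + chi ^+ 2 * (e + e ^+ 2 + eps)) ->
    chi ^+ 2 * e ^+ 2 <= d2 + eps * K2 * (chi * e + chi ^+ 2 * (1 + e ^+ 2)) ->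
    u <= d1 + lambda * d2 + tau.
Proof.
move=> K10 K20 tau0.
(* The total coefficient of P^2, where P = chi e: [K1] directly, and 4 K1^2 / tau from AM-GM applied
   to 2 K1 P at the cost of tau / 4. *)
pose M := K1 + 4 * K1 ^+ 2 / tau.
have M0 : 0 <= M by rewrite addr_ge0 // divr_ge0 ?mulr_ge0 ?exprn_ge0 // ltW.
exists (2 * M); first by rewrite mulr_ge0.
(* Chosen so that eps K2 <= 1/16 and that eps K1 and eps M K2 are at most tau / 16; the errors then
   total at most tau/4 + tau/16 + tau/4. *)
pose S := 16 * (1 + K1 + K2 + M * K2).
have MK0 : 0 <= M * K2 by rewrite mulr_ge0.
have S0 : 0 < S by rewrite /S; lra.
exists (Num.min (tau / S) (1 / S)); first by rewrite lt_min !divr_gt0.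
move=> eps chi e d1 d2 u /andP[eps0]; rewrite le_min => /andP[].
rewrite !ler_pdivlMr // => epstau eps1 /andP[chi0 chi1] e0 h1 h2.
pose P := chi * e; have P0 : 0 <= P by rewrite mulr_ge0.
have PP : chi ^+ 2 * e ^+ 2 = P ^+ 2 by rewrite exprMn.
have chi2 : chi ^+ 2 <= 1 by rewrite expr_le1.
have chi20 : 0 <= chi ^+ 2 by rewrite exprn_ge0.
have chie : chi ^+ 2 * e <= P.
  by rewrite /P expr2 -mulrA ler_piMl.
have epsK2 : 0 <= eps * K2 by rewrite mulr_ge0.
have bound2 : P ^+ 2 <= d2 + eps * K2 * (2 + 2 * P ^+ 2).
  rewrite -PP (le_trans h2) // lerD2l ler_wpM2l // mulrDr mulr1 PP -/P.
  by have := sqr_ge0 (P - 1); nra.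
have small : eps * K2 <= 1 / 16.
  have : eps * K2 * 16 <= eps * S by rewrite /S -mulrA ler_wpM2l //; lra.
  by move: eps1; lra.
have P2 : 0 <= P ^+ 2 by rewrite exprn_ge0.
have bound2' : P ^+ 2 <= 2 * d2 + 4 * (eps * K2).
  have : eps * K2 * (2 * P ^+ 2) <= 1 / 16 * (2 * P ^+ 2) by rewrite ler_wpM2r //; lra.
  by move: bound2; rewrite mulrDr; lra.
have bound1 : u <= d1 + K1 * (2 * P + P ^+ 2 + eps).
  rewrite (le_trans h1) // lerD2l ler_wpM2l // !mulrDr PP -/P.
  have : chi ^+ 2 * eps <= eps by rewrite ler_piMl.
  by move: chie; lra.
have amgm : K1 * (2 * P) <= tau / 4 + 4 * K1 ^+ 2 / tau * P ^+ 2.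
  have := sqr_ge0 (tau / 2 - 2 * K1 * P).
  rewrite -(pmulr_lge0 _ (_ : 0 < tau^-1)) ?invr_gt0 //.
  have -> : (tau / 2 - 2 * K1 * P) ^+ 2 * tau^-1 =
    tau / 4 + 4 * K1 ^+ 2 / tau * P ^+ 2 - K1 * (2 * P) by field; rewrite gt_eqF.
  by rewrite subr_ge0.
have MP : M * P ^+ 2 <= M * (2 * d2 + 4 * (eps * K2)) by rewrite ler_wpM2l.
have eK1 : eps * K1 * 16 <= tau.
  by rewrite (le_trans _ epstau) // /S -mulrA ler_wpM2l //; lra.
have eMK : eps * (M * K2) * 16 <= tau.
  by rewrite (le_trans _ epstau) // /S -mulrA ler_wpM2l //; lra.
have E : M * P ^+ 2 = K1 * P ^+ 2 + 4 * K1 ^+ 2 / tau * P ^+ 2 by rewrite /M mulrDl.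
rewrite !mulrDr in bound1.
have E2 : M * (2 * d2 + 4 * (eps * K2)) = 2 * M * d2 + 4 * (eps * (M * K2)) by ring.
clearbody M P; lra.
Qed.

End Absorption.

(** * The two fluxes and their divergence inequalities *)

Section Flux_inequalities.
Variables (R : realType) (n r : nat) (D : set 'rV[R]_n).
Hypothesis D_open : open D.
Variables (a : 'rV[R]_n) (l : R).
Hypotheses (l_gt0 : 0 < l) (box_sub : box a l `<=` D).
Variables (G g : 'rV[R]_n -> 'M[R]_r) (C : 'I_n -> 'I_n -> 'M[R]_r).
Hypotheses (C2G : C2_metric D G) (C2g : C2_metric D g).
Variables (B eps : R).
Hypotheses (B_ge0 : 0 <= B) (eps_ge0 : 0 <= eps).
Implicit Types (x : 'rV[R]_n) (i j : 'I_n).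

Local Notation N := (r%:R : R).
Local Notation chi := (bump a l).
(** The cut-off is squared so that its derivative still carries a factor chi: the boundary terms are
    then of size chi e, which chi^2 e^2 can absorb. *)
Let rho x : R := chi x * chi x.
Let E j x : 'M[R]_r := dmx j G x - dmx j g x.

(** On [D] the matrices E_i are symmetric, so this is the Frobenius norm of the gradient of G -
    g. *)
Definition defect x : R := Num.sqrt (\sum_i \tr (E i x *m E i x)).

(** Its divergence is minus chi^2 times the second order part of the difference of the curvature
    pairings, up to a term where the cut-off is differentiated. *)
Definition flux1 i x : R := - (rho x * \sum_j \tr (E j x *m C i j)).

(* [W] is only known to have small entries; subtracting [eps * N] from it makes the
   product with the negative semidefinite trace of the curvature nonnegative. *)
Definition flux2 i x : R := rho x * \tr ((G x - g x - (eps * N)%:M) *m E i x).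

Let rho_C1 : C1_on D rho.
Proof. by apply: (C1M D_open); exact: bump_C1. Qed.

Let E_C1 j : C1_mx D (E j).
Proof. by apply: (C1_mxB D_open); exact: C2_metric_dmx_C1. Qed.

Let dmx_E i j x : D x -> dmx i (E j) x = dmx i (dmx j G) x - dmx i (dmx j g) x.
Proof. by move=> Dx; apply: (dmxB D_open i _ _ Dx); exact: C2_metric_dmx_C1. Qed.

Let EC_C1 i j : C1_mx D (fun x => E j x *m C i j).
Proof. exact: (C1_mxM D_open (E_C1 j) (C1_mx_cst D_open (C i j))). Qed.

Let sumEC_C1 i : C1_on D (fun x => \sum_j \tr (E j x *m C i j)).
Proof. by apply: (C1_sum D_open) => j; exact: (C1_trace D_open (EC_C1 i j)). Qed.

Let W_C1 : C1_mx D (fun x => G x - g x - (eps * N)%:M).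
Proof.
apply: (C1_mxB D_open); last exact: C1_mx_cst.
by apply: (C1_mxB D_open); exact: C2_metric_C1.
Qed.

Let WE_C1 i : C1_mx D (fun x => (G x - g x - (eps * N)%:M) *m E i x).
Proof. exact: (C1_mxM D_open W_C1 (E_C1 i)). Qed.

Lemma flux1_C1 i : C1_on D (flux1 i).
Proof. exact: (C1N D_open (C1M D_open rho_C1 (sumEC_C1 i))). Qed.

Lemma flux2_C1 i : C1_on D (flux2 i).
Proof. exact: (C1M D_open rho_C1 (C1_trace D_open (WE_C1 i))). Qed.

Lemma flux1_face i x : x 0 i = a 0 i \/ x 0 i = a 0 i + l -> flux1 i x = 0.
Proof. by move=> /(bump_face l_gt0) c0; rewrite /flux1 /rho c0 !mul0r oppr0. Qed.

Lemma flux2_face i x : x 0 i = a 0 i \/ x 0 i = a 0 i + l -> flux2 i x = 0.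
Proof. by move=> /(bump_face l_gt0) c0; rewrite /flux2 /rho c0 !mul0r. Qed.

Lemma pd_flux1 i x : D x -> pd i (flux1 i) x =
  - (pd i rho x * \sum_j \tr (E j x *m C i j) +
     rho x * \sum_j \tr ((dmx i (dmx j G) x - dmx i (dmx j g) x) *m C i j)).
Proof.
move=> Dx; rewrite (pdN i (C1M D_open rho_C1 (sumEC_C1 i)) Dx).
rewrite (pdM i rho_C1 (sumEC_C1 i) Dx); congr (- (_ + _ * _)).
rewrite (pd_sum D_open (index_enum _) xpredT i (fun j => C1_trace D_open (EC_C1 i j)) Dx).
apply: eq_bigr => j _; rewrite (pd_trace D_open i (EC_C1 i j) Dx).
rewrite (dmxM D_open i (E_C1 j) (C1_mx_cst D_open (C i j)) Dx).
by rewrite dmx_cst mulmx0 addr0 dmx_E.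
Qed.

(** Differentiating the first factor of the trace produces tr (E_i E_i), whose sum over i is the
    square of [defect]. *)
Lemma pd_flux2 i x : D x -> pd i (flux2 i) x =
  pd i rho x * \tr ((G x - g x - (eps * N)%:M) *m E i x) +
  rho x * (\tr (E i x *m E i x) + \tr ((G x - g x - (eps * N)%:M) *m
    (dmx i (dmx i G) x - dmx i (dmx i g) x))).
Proof.
move=> Dx; rewrite (pdM i rho_C1 (C1_trace D_open (WE_C1 i)) Dx); congr (_ + _ * _).
rewrite (pd_trace D_open i (WE_C1 i) Dx) (dmxM D_open i W_C1 (E_C1 i) Dx) dmx_E //.
rewrite mxtraceD; congr (\tr (_ *m _) + _).
have CG := C2_metric_C1 C2G; have Cg := C2_metric_C1 C2g.
rewrite (dmxB D_open i (C1_mxB D_open CG Cg) (C1_mx_cst D_open _) Dx) dmx_cst subr0.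
by rewrite (dmxB D_open i CG Cg Dx).
Qed.

Let metric_sym (h : 'rV[R]_n -> 'M[R]_r) x : C2_metric D h -> D x -> (h x)^T = h x.
Proof. by move=> [mh _] Dx; case: (mh x Dx). Qed.

Let metric_unit (h : 'rV[R]_n -> 'M[R]_r) x : C2_metric D h -> D x -> h x \in unitmx.
Proof. by move=> [mh _] Dx; exact: metric_unitmx mh Dx. Qed.

Let sym_d (h : 'rV[R]_n -> 'M[R]_r) i x : C2_metric D h -> D x -> (dmx i h x)^T = dmx i h x.
Proof. by move=> Ch; apply: (dmx_sym D_open) => y; exact: metric_sym. Qed.

Let E_sym i x : D x -> (E i x)^T = E i x.
Proof. by move=> Dx; rewrite /E linearB /= !sym_d. Qed.

Lemma defect_ge0 x : 0 <= defect x.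
Proof. exact: sqrtr_ge0. Qed.

Let E_le i x : D x -> entries_le (E i x) (defect x).
Proof.
by move=> Dx; apply: (entries_le_sqrt_trace (E := E^~ x)) => k; exact: E_sym.
Qed.

Let defect_sqr x : D x -> defect x ^+ 2 = \sum_i \tr (E i x *m E i x).
Proof.
move=> Dx; rewrite sqr_sqrtr //; apply: sumr_ge0 => i _.
apply: sumr_ge0 => s _; rewrite mxE; apply: sumr_ge0 => t _.
have -> : E i x t s = E i x s t by rewrite -[in LHS](E_sym i Dx) [LHS]mxE.
by rewrite -expr2 sqr_ge0.
Qed.

Section At_a_point.
Variable x : 'rV[R]_n.
Hypothesis x_in : box a l x.
Hypotheses (chi_le : forall i, `|pd i chi x| <= B)
  (dg_le : forall i, entries_le (dmx i g x) B)
  (ddg_le : forall i, entries_le (dmx i (dmx i g) x) B)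
  (inv_le : entries_le (invmx (g x)) B) (invG_le : entries_le (invmx (G x)) B)
  (C_le : forall i j, entries_le (C i j) B)
  (W_le : entries_le (G x - g x) eps).

Let Dx : D x := box_sub x_in.
Let chi0 : 0 <= chi x. Proof. by have /andP[] := bump_ge0_le1 l_gt0 x_in. Qed.

Let pd_rho_le i : `|pd i rho x| <= 2 * B * chi x.
Proof.
have Cb := bump_C1 D_open a l.
rewrite /rho (pdM i Cb Cb Dx) (le_trans (ler_normD _ _)) // !normrM (ger0_norm chi0).
by have := ler_wpM2r chi0 (chi_le i); lra.
Qed.

Let trB (X Y : 'M[R]_r) : \tr (X - Y) = \tr X - \tr Y.
Proof. exact: raddfB. Qed.

Let tr_sum (X : 'I_n -> 'M[R]_r) : \tr (\sum_i X i) = \sum_i \tr (X i).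
Proof. exact: raddf_sum. Qed.

Let tr_sub_mul (X Y Z U V : 'M[R]_r) :
  \tr ((X - Y) *m V) - \tr ((Z - U) *m V) = \tr ((X - Z) *m V) - \tr ((Y - U) *m V).
Proof. by rewrite !mulmxBl !trB; ring. Qed.

Let sub_chain (X Y Z : 'M[R]_r) : Y - Z + (X - Y) = X - Z.
Proof. by rewrite addrC addrA subrK. Qed.

(** Let T1 be the second order and T2 the quadratic part of the difference of the pairings; the
    hypotheses give delta <= T2 - T1. After multiplication by chi^2, - T1 becomes the divergence
    plus T3, which comes from the derivative of chi^2. [quadratic_term_diff] bounds T2, and T3 is at
    most a constant times chi e. *)
Lemma flux1_ineq (delta : R) :
  \sum_i \sum_j \tr (lowered_curv G i j x *m C i j) <= 0 ->
  delta <= \sum_i \sum_j \tr (lowered_curv g i j x *m C i j) ->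
  delta * chi x ^+ 2 <= \sum_i pd i (flux1 i) x +
    n%:R ^+ 2 * (K_quad r B + 2 * N ^+ 2 * B ^+ 2) *
    (chi x * defect x + chi x ^+ 2 * (defect x + defect x ^+ 2 + eps)).
Proof.
move=> SG Sg; set e := defect x; have e0 : 0 <= e := defect_ge0 x.
pose T1 := \sum_i \sum_j \tr ((dmx i (dmx j G) x - dmx i (dmx j g) x) *m C i j).
pose T2 := \sum_i \sum_j \tr ((dmx i G x *m invmx (G x) *m dmx j G x -
  dmx i g x *m invmx (g x) *m dmx j g x) *m C i j).
pose T3 := \sum_i pd i rho x * \sum_j \tr (E j x *m C i j).
have div : \sum_i pd i (flux1 i) x = - (T3 + rho x * T1).
  rewrite /T3 /T1 mulr_sumr -big_split /= -sumrN; apply: eq_bigr => i _.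
  exact: pd_flux1.
have diff : \sum_i \sum_j \tr (lowered_curv G i j x *m C i j) -
    \sum_i \sum_j \tr (lowered_curv g i j x *m C i j) = T1 - T2.
  rewrite -!sumrB; apply: eq_bigr => i _; rewrite -!sumrB; apply: eq_bigr => j _.
  exact: tr_sub_mul.
have T2_le : T2 <= n%:R ^+ 2 * (K_quad r B * (e + e ^+ 2 + eps)).
  apply: (@le_trans _ _ (\sum_(i < n) \sum_(j < n) K_quad r B * (e + e ^+ 2 + eps))).
    apply: ler_sum => i _; apply: ler_sum => j _; apply: (le_trans (ler_norm _)).
    by apply: quadratic_term_diff => //; do ?[exact: metric_unit|exact: E_le].
  rewrite !sumr_const !card_ord -[_ *+ n *+ n]mulr_natl -[_ *+ n]mulr_natl.
  by rewrite le_eqVlt; apply/orP; left; apply/eqP; ring.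
have T3_le : T3 <= n%:R ^+ 2 * (2 * N ^+ 2 * B ^+ 2 * (chi x * e)).
  apply: (@le_trans _ _ (\sum_(i < n) (2 * B * chi x) * (n%:R * (N * (N * e * B))))).
    apply: ler_sum => i _; apply: (le_trans (ler_norm _)); rewrite normrM.
    apply: ler_pM => //; apply: (le_trans (ler_norm_sum _ _ _)).
    rewrite mulr_natl -[X in _ <= _ *+ X](card_ord n) -sumr_const.
    apply: ler_sum => j _; apply: entries_le_trace; apply: entries_leM => //.
    exact: E_le.
  rewrite sumr_const card_ord -[_ *+ n]mulr_natl.
  by rewrite le_eqVlt; apply/orP; left; apply/eqP; ring.
have rhoE : rho x = chi x ^+ 2 by rewrite /rho expr2.
have rho0 : 0 <= chi x ^+ 2 by rewrite exprn_ge0.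
have K0 := K_quad_ge0 r B_ge0.
have h0 : delta <= T2 - T1.
  by rewrite (le_trans Sg) // -[T2 - T1]opprB -diff opprB lerBrDr -lerBrDl subrr.
have h1 := ler_wpM2r rho0 h0.
have h2 : T2 * chi x ^+ 2 <= n%:R ^+ 2 * (K_quad r B * (e + e ^+ 2 + eps)) * chi x ^+ 2.
  by rewrite ler_wpM2r.
have p1 : 0 <= n%:R ^+ 2 * K_quad r B * (chi x * e).
  by rewrite !mulr_ge0 ?exprn_ge0.
have p2 : 0 <= n%:R ^+ 2 * (2 * N ^+ 2 * B ^+ 2) * (chi x ^+ 2 * (e + e ^+ 2 + eps)).
  by rewrite !mulr_ge0 ?addr_ge0 ?exprn_ge0.
rewrite div rhoE.
clear SG Sg diff h0 T2_le div K0 rho0; clearbody T1 T2 T3 e.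
move: (chi x) (K_quad r B) h1 h2 T3_le p1 p2 => c K h1 h2 T3_le p1 p2.
lra.
Qed.

Let lowered_curv_sym i : (lowered_curv G i i x)^T = lowered_curv G i i x.
Proof.
have L_sym : (dmx i (dmx i G) x)^T = dmx i (dmx i G) x.
  by apply: (dmx_sym D_open) Dx => y; exact: sym_d.
have trmxB (X Y : 'M[R]_r) : (X - Y)^T = X^T - Y^T.
  by apply/matrixP => s t; rewrite !mxE.
rewrite /lowered_curv trmxB L_sym !trmx_mul trmx_inv.
by rewrite (metric_sym C2G Dx) (sym_d i C2G Dx) mulmxA.
Qed.

(** Write the second derivatives of G - g, summed over i = j, as Q - P with P = - sum_i L_ii(G)
    positive semidefinite. The shift of W gives tr (W P) <= 0, so this term has the good sign. Q
    involves only first derivatives of G and data of g, so tr (W Q) is of size eps (1 + e^2). *)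
Lemma flux2_ineq :
  (forall v : 'rV[R]_r,
     0 <= - \sum_i (v *m lowered_curv G i i x *m v^T) 0 0) ->
  chi x ^+ 2 * defect x ^+ 2 <= \sum_i pd i (flux2 i) x +
    eps * (n%:R * (1 + N) * N ^+ 2 *
      (2 * B + (2 * N ^+ 2 * B ^+ 3 + 2 * N ^+ 2 * B + B))) *
    (chi x * defect x + chi x ^+ 2 * (1 + defect x ^+ 2)).
Proof.
move=> trace_neg; set e := defect x; have e0 : 0 <= e := defect_ge0 x.
pose W : 'M[R]_r := G x - g x - (eps * N)%:M.
pose w := (1 + N) * eps; have w0 : 0 <= w by rewrite mulr_ge0 // addr_ge0.
have Ww : entries_le W w.
  have -> : w = eps + eps * N by rewrite /w; ring.
  apply: entries_leD => //; apply: entries_leN => s t; rewrite mxE normrMn.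
  rewrite ger0_norm ?mulr_ge0 //; case: (s == t) => //=; exact: mulr_ge0.
pose P : 'M[R]_r := - \sum_i lowered_curv G i i x.
have P_psd : psd P.
  move=> v; have := trace_neg v; congr (0 <= _).
  by rewrite /P mulmxN mulNmx mulmx_sumr mulmx_suml mxE summxE.
have P_sym : P^T = P.
  have trE (A : 'M[R]_r) s t : A^T s t = A t s by rewrite mxE.
  apply/matrixP => s t; rewrite trE /P [LHS]mxE [RHS]mxE !summxE; congr (- _).
  by apply: eq_bigr => i _; rewrite -trE lowered_curv_sym.
(* [trace_mul_psd_le] gives tr ((G - g) P) <= eps N tr P, exactly what the scalar matrix
   subtracts. *)
have WP : \tr (W *m P) <= 0.
  rewrite /W mulmxBl trB mul_scalar_mx mxtraceZ subr_le0.
  exact: trace_mul_psd_le.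
pose Q : 'M[R]_r := \sum_i (dmx i G x *m invmx (G x) *m dmx i G x - dmx i (dmx i g) x).
pose T3 := \sum_i pd i rho x * \tr (W *m E i x).
have div : \sum_i pd i (flux2 i) x =
    T3 + chi x ^+ 2 * (e ^+ 2 + \tr (W *m (Q - P))).
  have -> : \tr (W *m (Q - P)) =
      \sum_i \tr (W *m (dmx i (dmx i G) x - dmx i (dmx i g) x)).
    rewrite -tr_sum -mulmx_sumr; congr (\tr (_ *m _)).
    rewrite /P opprK -big_split; apply: eq_bigr => i _ /=.
    exact: sub_chain.
  rewrite (defect_sqr Dx) -big_split expr2 mulr_sumr -big_split.
  by apply: eq_bigr => i _; exact: pd_flux2.
have Q_le : `|\tr (W *m Q)| <= N * (N * w * (n%:R * (N * (N * (B + e) * B) * (B + e) + B))).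
  apply: entries_le_trace; apply: entries_leM => //; apply: entries_le_sum => i.
  have D_le : entries_le (dmx i G x) (B + e).
    by rewrite -(subrK (dmx i g x) (dmx i G x)) addrC; apply: entries_leD => //; exact: E_le.
  apply: entries_leD; last exact: entries_leN.
  by apply: entries_leM => //; apply: entries_leM.
have Q_le' : `|\tr (W *m Q)| <= eps * (n%:R * (1 + N) * N ^+ 2 *
    (2 * N ^+ 2 * B ^+ 3 + 2 * N ^+ 2 * B + B)) * (1 + e ^+ 2).
  apply: (le_trans Q_le); rewrite -subr_ge0 /w.
  (* The difference is made visibly nonnegative through (B + e)^2 = 2 B^2 + 2 e^2 - (B - e)^2. *)
  have -> : eps * (n%:R * (1 + N) * N ^+ 2 *
    (2 * N ^+ 2 * B ^+ 3 + 2 * N ^+ 2 * B + B)) * (1 + e ^+ 2)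
    - N * (N * ((1 + N) * eps) * (n%:R * (N * (N * (B + e) * B) * (B + e) + B)))
    = eps * n%:R * (1 + N) * N ^+ 2 * (N ^+ 2 * B * ((B - e) ^+ 2) +
       2 * N ^+ 2 * B ^+ 3 * e ^+ 2 + 2 * N ^+ 2 * B + B * e ^+ 2) by ring.
  have := sqr_ge0 (B - e); move: ((B - e) ^+ 2) => z z0.
  by rewrite !(mulr_ge0, addr_ge0, exprn_ge0).
have T3_le : - T3 <= eps * (n%:R * (1 + N) * N ^+ 2 * (2 * B)) * (chi x * e).
  apply: (@le_trans _ _ (\sum_(i < n) (2 * B * chi x) * (N * (N * w * e)))).
    rewrite -sumrN; apply: ler_sum => i _; apply: (le_trans (ler_norm _)).
    rewrite normrN normrM; apply: ler_pM => //; apply: entries_le_trace.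
    by apply: entries_leM => //; exact: E_le.
  rewrite sumr_const card_ord -[_ *+ n]mulr_natl le_eqVlt; apply/orP; left; apply/eqP.
  by rewrite /w; ring.
have rho0 : 0 <= chi x ^+ 2 by rewrite exprn_ge0.
have E1 : \tr (W *m (Q - P)) = \tr (W *m Q) - \tr (W *m P).
  by rewrite mulmxBr trB.
move: Q_le'; set KQ := eps * _ => Q_le'.
have h1 : - \tr (W *m (Q - P)) <= KQ * (1 + e ^+ 2).
  by move: Q_le'; rewrite E1 ler_norml => /andP[]; lra.
have h2 := ler_wpM2l rho0 h1.
have p1 : 0 <= KQ * (chi x * e).
  by rewrite /KQ !(mulr_ge0, addr_ge0, exprn_ge0).
have p2 : 0 <= eps * (n%:R * (1 + N) * N ^+ 2 * (2 * B)) * (chi x ^+ 2 * (1 + e ^+ 2)).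
  by rewrite !(mulr_ge0, addr_ge0, exprn_ge0).
have -> : eps * (n%:R * (1 + N) * N ^+ 2 *
      (2 * B + (2 * N ^+ 2 * B ^+ 3 + 2 * N ^+ 2 * B + B))) =
    eps * (n%:R * (1 + N) * N ^+ 2 * (2 * B)) + KQ by rewrite /KQ; ring.
rewrite div.
clear div Q_le Q_le' WP Ww w0 h1 rho0 E1; clearbody T3 KQ W Q P e.
move: (\tr _) (chi x) h2 T3_le p1 p2 => t c h2 T3_le p1 p2.
move: (eps * _) T3_le p2 => K T3_le p2.
lra.
Qed.

End At_a_point.

End Flux_inequalities.

(** * The monotone limit *)

Lemma continuous_sum (R : realType) (T : topologicalType) (I : Type) (s : seq I)
  (F : I -> T -> R) (x : T) : (forall k, {for x, continuous (F k)}) ->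
  {for x, continuous (fun y => \sum_(k <- s) F k y)}.
Proof.
move=> cF; elim: s => [|k s IH].
  have -> : (fun y => \sum_(k <- [::]) F k y) = cst 0.
    by apply/funext => y; rewrite big_nil.
  exact: cst_continuous.
have -> : (fun y => \sum_(j <- k :: s) F j y) = F k \+ (fun y => \sum_(j <- s) F j y).
  by apply/funext => y; rewrite big_cons.
exact: continuousD.
Qed.

Section Monotone_limit.
Variables (R : realType) (n r : nat) (D : set 'rV[R]_n).
Hypothesis D_open : open D.
Variables (gs : nat -> 'rV[R]_n -> 'M[R]_r) (g : 'rV[R]_n -> 'M[R]_r).
Hypotheses (C2gs : forall j, C2_metric D (gs j)) (C2g : C2_metric D g).
Hypothesis gs_mono : forall i j, (i <= j)%N -> forall x, D x ->
  mx_le (gs i x) (gs j x) /\ mx_le (gs j x) (g x).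

(* The trace of [g - g_j] decreases to 0 and dominates all the entries, so Dini's
   argument applies to it. *)
Lemma uniform_convergence (a : 'rV[R]_n) (l e : R) : box a l `<=` D -> 0 < e ->
  (forall x, D x -> forall s t, (fun j => gs j x s t) @ \oo --> g x s t) ->
  exists m, forall x, box a l x -> entries_le (gs m x - g x) e.
Proof.
move=> box_sub e0 conv.
have tr_decr i j x : (i <= j)%N -> D x -> \tr (g x - gs j x) <= \tr (g x - gs i x).
  move=> ij Dx; have [le_ij _] := gs_mono ij Dx; apply: ler_sum => k _.
  by have := psd_diag k le_ij; rewrite !mxE; lra.
have := @compact_box R n a l; move=> /compact_near_coveringP.
move=> /(_ nat \oo (fun j x => \tr (g x - gs j x) < e)) near_cov.
suff cov : \forall j \near \oo, box a l `<=` (fun x => \tr (g x - gs j x) < e).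
  near \oo => m; exists m => x bx s t; have Dx := box_sub x bx.
  have [_ le_g] := gs_mono (leqnn m) Dx.
  have sym (h : 'rV[R]_n -> 'M[R]_r) : C2_metric D h -> (h x)^T = h x.
    by move=> [mh _]; case: (mh x Dx).
  rewrite -opprB mxE normrN (le_trans (psd_entry_trace s t le_g _)) //.
    by rewrite linearB /= (sym _ C2g) (sym _ (C2gs m)).
  apply: ltW; exact: (near cov m).
apply: near_cov => x /box_sub Dx.
have er0 : 0 < e / r.+1%:R by rewrite divr_gt0.
have diag_conv : \forall j \near \oo, forall k : 'I_r, `|g x k k - gs j x k k| < e / r.+1%:R.
  by apply: filter_forall => k; have /cvgr_dist_lt /(_ _ er0) := conv x Dx k k.
have [m0 trm0] : exists m0, \tr (g x - gs m0 x) < e.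
  near \oo => m0; exists m0.
  apply: (@le_lt_trans _ _ (\sum_(k < r) e / r.+1%:R)).
    apply: ler_sum => k _; rewrite !mxE (le_trans (ler_norm _)) // ltW //.
    by move: k; near: m0.
  rewrite sumr_const card_ord -[_ *+ r]mulr_natl mulrCA gtr_pMr //.
  by rewrite ltr_pdivrMr // mul1r ltr_nat.
have trC1 : C1_on D (fun y => \tr (g y - gs m0 y)).
  exact: (C1_trace D_open (C1_mxB D_open (C2_metric_C1 C2g) (C2_metric_C1 (C2gs m0)))).
(* The bound at the index m0 persists near x by continuity, and for all later indices because the
   trace decreases. *)
exists ([set y | D y /\ \tr (g y - gs m0 y) < e], [set j | (m0 <= j)%N]).
  split; last exact: nbhs_infty_ge.
  apply: filterI; first exact: near_domain.
  exact: (cvgr_lt _ (C1_continuous trC1 Dx)).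
move=> [y j] /= [[Dy tr_y] m0j]; apply: le_lt_trans tr_y; exact: tr_decr.
Unshelve. all: by end_near. Qed.

End Monotone_limit.

Section Curvature_pairing.
Variables (R : realType) (n r : nat) (D : set 'rV[R]_n).
Hypothesis D_open : open D.
Variables (g : 'rV[R]_n -> 'M[R]_r) (C : 'I_n -> 'I_n -> 'M[R]_r).
Hypothesis C2g : C2_metric D g.

Lemma continuous_dmx2 i j s t x : D x ->
  {for x, continuous (fun y => dmx i (dmx j g) y s t)}.
Proof.
move=> Dx; apply: (on_eq_continuous D_open (f := pd i (fun z => dmx j g z s t))) => //.
  by move=> y _; rewrite [in RHS]mxE.
exact: (@C1_pd_continuous _ _ _ _ _ (C2_metric_dmx_C1 D_open j C2g s t) Dx i).
Qed.

Lemma continuous_curv_pairing x : D x -> {for x, continuous (fun y =>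
  \sum_i \sum_j \tr (lowered_curv g i j y *m C i j))}.
Proof.
move=> Dx; do 2!apply: continuous_sum => ?; rewrite /mxtrace.
apply: continuous_sum => s.
pose f i j y : R := \sum_t lowered_curv g i j y s t * C i j t s.
apply: (on_eq_continuous D_open (f := f _ _)) => //.
  by move=> y _; rewrite [in RHS]mxE.
apply: continuous_sum => t.
apply: continuousM; last exact: cst_continuous.
have CP i j := C1_mxM D_open (C1_mxM D_open (C2_metric_dmx_C1 D_open i C2g)
  (C2_metric_inv_C1 D_open C2g)) (C2_metric_dmx_C1 D_open j C2g).
have subE (X Y : 'M[R]_r) : (X - Y) s t = X s t - Y s t by rewrite !mxE.
pose f2 i j y : R := dmx i (dmx j g) y s t -
  (dmx i g y *m invmx (g y) *m dmx j g y) s t.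
apply: (on_eq_continuous D_open (f := f2 _ _)) => //.
  by move=> y _; exact: esym (subE _ _).
apply: continuousB; first exact: continuous_dmx2.
exact: (C1_continuous (CP _ _ s t) Dx).
Qed.

End Curvature_pairing.

Theorem theorem1p2 (R : realType) (n r q : nat) (D : set 'rV[R]_n)
  (gs : nat -> 'rV[R]_n -> 'M[R]_r) (g : 'rV[R]_n -> 'M[R]_r) :
  domain D ->
  (1 <= q <= n)%N ->
  (forall j, C2_metric D (gs j)) ->
  (forall j, nakano_q_semipositive D q (gs j)) ->
  C2_metric D g ->
  (forall i j, (i <= j)%N -> forall x, D x ->
     mx_le (gs i x) (gs j x) /\ mx_le (gs j x) (g x)) ->
  (forall x, D x -> forall a b : 'I_r,
     (fun j => gs j x a b) @ \oo --> g x a b) ->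
  nakano_q_semipositive D q g.
Proof.
move=> [D_open _] qn C2gs nak_gs C2g mono conv x0 Dx0 alpha.
rewrite (form_inner_Theta _ _ D_open C2g Dx0) oppr_ge0.
pose C := form_tensor q alpha.
pose pairing (h : 'rV[R]_n -> 'M[R]_r) x :=
  \sum_i \sum_j \tr (lowered_curv h i j x *m C i j).
rewrite leNgt; apply/negP => pair_gt0.
(* Half the value at x0, so that by continuity the pairing still exceeds delta on a whole
   neighbourhood. *)
pose delta := pairing g x0 / 2.
have delta_gt0 : 0 < delta by rewrite divr_gt0.
have [e e0 near_x0] : exists2 e : R, 0 < e &
    forall y : 'rV[R]_n, (forall i, `|y 0 i - x0 0 i| < e) -> D y /\ delta < pairing g y.
  apply: nbhs_coord; apply: filterI; first exact: near_domain.
  have /cvgr_gt := @continuous_curv_pairing _ _ _ _ D_open g C C2g x0 Dx0.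
  by apply; rewrite /delta ltr_pdivrMr // ltr_pMr // ltr1n.
(* Half of e keeps the closed box inside the neighbourhood given by strict inequalities. *)
pose l := e / 2; have l_gt0 : 0 < l by rewrite divr_gt0.
have box_near y : box x0 l y -> D y /\ delta < pairing g y.
  move=> yb; apply: near_x0 => i; have /andP[yl yr] := yb i.
  rewrite ger0_norm ?subr_ge0 // ltrBlDl (le_lt_trans yr) // ltrD2l.
  by rewrite ltr_pdivrMr // ltr_pMr // ltr1n.
have box_sub : box x0 l `<=` D by move=> y /box_near[].
(* [B] has to be fixed before the index m: the inverses of all [gs m] are bounded through the trace
   of the inverse of [gs 0]. *)
have [B B_ge0 [chiB dgB ddgB invB [inv0B CB]]] : exists2 B : R, 0 <= B &
    [/\ forall i y, box x0 l y -> `|pd i (bump x0 l) y| <= B,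
        forall i s t y, box x0 l y -> `|dmx i g y s t| <= B,
        forall i s t y, box x0 l y -> `|dmx i (dmx i g) y s t| <= B,
        forall s t y, box x0 l y -> `|invmx (g y) s t| <= B &
        (forall y, box x0 l y -> `|\tr (invmx (gs 0%N y))| <= B) /\
        forall i j s t y, box x0 l y -> `|C i j s t| <= B].
  have bd := @bounded_on_box R n x0 l.
  near (pinfty_nbhs R) => B; exists B; first by near: B; exact: nbhs_pinfty_ge.
  split; last split; near: B; do ?[apply: filter_forall => ?]; apply: bd => y /box_sub Dy.
  - exact: (@C1_pd_continuous _ _ _ _ _ (bump_C1 D_open x0 l) Dy).
  - exact: (C1_continuous (C2_metric_dmx_C1 D_open _ C2g _ _) Dy).
  - exact: continuous_dmx2 Dy.
  - exact: (C1_continuous (C2_metric_inv_C1 D_open C2g _ _) Dy).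
  - exact: (C1_continuous (C1_trace D_open (C2_metric_inv_C1 D_open (C2gs 0%N))) Dy).
  - exact: cst_continuous.
pose K1 : R := n%:R ^+ 2 * (K_quad r B + 2 * r%:R ^+ 2 * B ^+ 2).
pose K2 : R := n%:R * (1 + r%:R) * r%:R ^+ 2 *
  (2 * B + (2 * r%:R ^+ 2 * B ^+ 3 + 2 * r%:R ^+ 2 * B + B)).
have K1_ge0 : 0 <= K1.
  have := K_quad_ge0 r B_ge0; move: (K_quad _ _) => K K0.
  by rewrite !(mulr_ge0, addr_ge0, exprn_ge0).
have K2_ge0 : 0 <= K2 by rewrite !(mulr_ge0, addr_ge0, exprn_ge0).
(* Half of the constant in [bump_not_divergence], whose conclusion then becomes absurd. *)
pose tau := delta * (1 / 4) ^+ n / 2.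
have quarter_gt0 : 0 < delta * (1 / 4) ^+ n by rewrite mulr_gt0 ?exprn_gt0.
have tau_gt0 : 0 < tau by rewrite divr_gt0.
have [lambda lambda_ge0 [eps eps_gt0 absorb]] := absorb_gradient K1_ge0 K2_ge0 tau_gt0.
(* Only now is m chosen: eps depends on [K1], [K2] and tau, none of which involves m. *)
have [m close] := uniform_convergence D_open C2gs C2g mono box_sub eps_gt0 conv.
pose F i x := flux1 x0 l (gs m) g C i x + lambda * flux2 x0 l (gs m) g eps i x.
have F1C i := flux1_C1 D_open x0 l C (C2gs m) C2g i.
have F2C i := flux2_C1 D_open x0 l (C2gs m) C2g eps i.
have lF2C i := C1M D_open (C1_cst D_open lambda) (F2C i).
have div_F y : D y -> \sum_i pd i (F i) y = \sum_i pd i (flux1 x0 l (gs m) g C i) y +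
    lambda * \sum_i pd i (flux2 x0 l (gs m) g eps i) y.
  move=> Dy; rewrite mulr_sumr -big_split; apply: eq_bigr => i _ /=.
  rewrite (pdD i (F1C i) (lF2C i) Dy) (pdM i (C1_cst D_open lambda) (F2C i) Dy).
  by rewrite pd_cst mul0r add0r.
suff : delta * (1 / 4) ^+ n <= tau.
  by rewrite leNgt ltr_pdivrMr // ltr_pMr // ltr1n.
apply: (bump_not_divergence l_gt0 box_sub (ltW delta_gt0) (F := F)).
- by move=> i; exact: (C1D D_open (F1C i) (lF2C i)).
- by move=> i x _ xi; rewrite /F flux1_face // flux2_face // mulr0 addr0.
move=> x bx; have [Dx gx] := box_near x bx; rewrite (div_F x Dx).
have [sym0 pos0] := (C2gs 0%N).1 x Dx; have [symm posm] := (C2gs m).1 x Dx.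
have psd0 : psd (gs 0%N x).
  move=> v; have [->|/pos0/ltW //] := eqVneq v 0.
  by rewrite !mul0mx mxE.
have invG_le : entries_le (invmx (gs m x)) B.
  move=> s t; apply: le_trans (le_trans (ler_norm _) (inv0B x bx)).
  apply: invmx_entry_le => //.
  - exact: metric_unitmx (C2gs 0%N).1 Dx.
  - exact: metric_unitmx (C2gs m).1 Dx.
  - exact: (mono _ _ (leq0n m) x Dx).1.
have pairing_le0 : \sum_i \sum_j \tr (lowered_curv (gs m) i j x *m C i j) <= 0.
  by have := nak_gs m x Dx alpha;
    rewrite (form_inner_Theta _ _ D_open (C2gs m) Dx) oppr_ge0.
apply: (absorb eps (bump x0 l x) (defect (gs m) g x)).
- by rewrite ltW /=.
- exact: bump_ge0_le1.
- exact: defect_ge0.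
- have [dg_le W_le] : (forall i, entries_le (dmx i g x) B) /\
      entries_le (gs m x - g x) eps.
    by split; [move=> i s t; exact: dgB|exact: close].
  have inv_le : entries_le (invmx (g x)) B by move=> s t; exact: invB.
  have C_le i j : entries_le (C i j) B by move=> s t; exact: CB bx.
  exact: (flux1_ineq D_open l_gt0 box_sub (C2gs m) C2g B_ge0 (ltW eps_gt0) bx
    (fun i => chiB i x bx) dg_le inv_le invG_le C_le W_le pairing_le0 (ltW gx)).
- apply: (flux2_ineq D_open l_gt0 box_sub (C2gs m) C2g B_ge0 (ltW eps_gt0) bx).
  + by move=> i; exact: chiB.
  + by move=> i s t; exact: dgB.
  + by move=> i s t; exact: ddgB.
  + exact: invG_le.
  + exact: close.
  + by move=> v; exact: (nakano_trace v D_open qn (C2gs m) (nak_gs m) Dx).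
Unshelve. all: by end_near. Qed.
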